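(* Let $E \subset \mathbb{T}$ be a closed set of measure $0$. Let $g \in H^2$ be non-vanishing on $\mathbb{D}$, and let $f \in C(E)$ be non-vanishing on $E$. Then there exists a sequence of polynomials $P_n$ which do not vanish on the closed unit disc $\overline{\mathbb{D}}$ such that $P_n \to g$ in $H^2$ and $P_n \to f$ uniformly on $E$.
   Context: $\mathbb{D}$ is the open unit disc, $\mathbb{T}$ the unit circle with arc-length measure. $H^2$ is the Hardy space of holomorphic functions $\sum_k a_kz^k$ on $\mathbb{D}$ with norm $\|f\|_{H^2}^2=\sum_k|a_k|^2$. $C(E)$ is the space of continuous functions on $E$ with the sup norm. *)

(* Defs.v *)
From mathcomp Require Import all_boot all_algebra all_classical all_reals all_analysis.
From mathcomp Require Import Rstruct Rstruct_topology.
From Stdlib Require Import Reals.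
From Coquelicot Require Import Coquelicot.

Local Open Scope classical_set_scope.

Definition null_on_circle (E : C -> Prop) : Prop :=
  (@lebesgue_measure R).-negligible
    [set t : R | (0 <= t < 2 * PI)%R /\ E (Rtrigo_def.cos t, Rtrigo_def.sin t)].

Local Close Scope classical_set_scope.

Definition poly_eval (p : list C) (z : C) : C :=
  List.fold_right (fun c acc => Cplus c (Cmult z acc)) (RtoC 0%R) p.

Definition poly_coef (p : list C) (k : nat) : C := List.nth k p (RtoC 0%R).

(* Squared H^2 distance between the function with Taylor coefficients a
   and the polynomial p: sum_k |a_k - p_k|^2. *)
Definition H2_dist2 (a : nat -> C) (p : list C) : R :=
  Series (fun k => (Cmod (Cminus (a k) (poly_coef p k)) ^ 2)%R).

(* Main.v *)
(** Dilating g and truncating its Taylor series gives a polynomial q, zero-free on the closed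
    disc and close to g in H^2.  Since E is null it splits into finitely many pieces at positive
    mutual distance on which f/q is nearly constant, equal to w_j say, so it suffices to multiply
    a zero-free polynomial by something close to w_j on one piece, close to 1 on the others and
    close to 1 in L^2.  Cover the piece by m discs of radius d centered at c_i on the circle with
    m d tiny; then H(z) = sum_i d/(1 + d - conj(c_i) z) has positive real part on the disc, real
    part >= 1/4 on the piece, and is tiny away from the piece and at 0.  For large N the function
    phi = N H/(1 + N H) takes values in the disc with diameter [0,1], i.e. |phi|^2 <= Re phi, so
    ||phi||_2^2 <= Re phi(0) is tiny, while phi is close to 1 on the piece and to 0 on the others.
    Writing w_j = s^4 with Re s > 0, the factor (1 + (s - 1) phi)^4 is zero-free and does the
    job.  Means over the circle are replaced by means over roots of unity of large order, which
    are exact for polynomials. *)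
From mathcomp Require all_boot all_order all_algebra all_classical all_reals all_analysis.
From mathcomp Require measurable_realfun Rstruct Rstruct_topology.
From Stdlib Require Reals Lra.

(** The order of the choices makes the two demands compatible. The polynomial q is fixed first,
    without regard to f, so f/q may be huge or tiny on E; the pieces depend on q through its
    Lipschitz constant, and each phi is chosen last. Correcting one piece costs, in squared norm, a
    constant depending on s and on the polynomial being corrected, times a mean of Re phi that can
    be made as small as desired once this constant is known. The factor must be zero-free on the
    whole closed disc, not merely close to 1 in L^2. This is why the values of phi are confined to a
    disc rather than bounded in modulus, and why passing from the rational phi to a polynomial needs
    an error that is uniform on the closed disc. Fourth roots enter because the disc with diameter
    [1, w_j] may contain 0, whereas the one with diameter [1, s] does not. Boundary values of g
    never occur, since its H^2 distance is handled on coefficients. *)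

Module Measure.
Import all_boot all_order all_algebra all_classical all_reals all_analysis measurable_realfun.
Import Order.TTheory GRing.Theory Num.Theory numFieldNormedType.Exports.
Local Open Scope classical_set_scope.
Local Open Scope ring_scope.

(** * Counting grid cells inside open neighbourhoods of null sets *)

Lemma grid_measure (R : realType) (U : set R) (h : R) (b : nat -> bool) (n : nat) :
  open U -> 0 <= h ->
  (forall i, (i < n)%N -> b i ->
     forall t, i%:R * h <= t -> t < i.+1%:R * h -> U t) ->
  (((\sum_(i < n) b i)%N%:R * h)%:E <= lebesgue_measure (U `&` `]-oo, (n%:R * h)%R[))%E.
Proof.
move=> oU h0; have mU : measurable U by exact: open_measurable.
elim: n => [|n IH] Hb; first by rewrite big_ord0 mul0r.
have {}IH := IH (fun i Hi => Hb i (ltnW Hi)).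
rewrite big_ord_recr /= natrD mulrDl EFinD.
have mI x : measurable (U `&` `]-oo, x[ : set R) by exact: measurableI.
have h1 : n%:R * h <= n.+1%:R * h by rewrite ler_wpM2r// ler_nat.
case Hbn : (b n); last first.
  rewrite mul0r adde0; apply: (le_trans IH); apply: le_measure; [exact: (mem_set (mI _))..|].
  by move=> x /= [Ux]; rewrite ?in_itv /= => /lt_le_trans xh; split=> //; exact: xh.
have mC : measurable (`[n%:R * h, n.+1%:R * h[ : set R) by [].
have -> : (true%:R * h)%:E = lebesgue_measure (`[n%:R * h, n.+1%:R * h[ : set R).
  rewrite lebesgue_measure_itv /= lte_fin -EFinD -mulrBl -natrB// subSnn.
  (* The length formula returns 0 on an empty cell, which happens only for h = 0. *)
  case: ifPn => //; rewrite -leNgt => h2.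
  have -> : h = 0; last by rewrite mulr0.
  apply/eqP; rewrite eq_le h0 andbT.
  by move: h2; rewrite -subr_ge0 -mulrBl -[n.+1]addn1 natrD opprD addNKr mulN1r oppr_ge0.
(* Cutting [U] at n h makes the measures add up: the new cell starts where the old region ends. *)
apply: (@le_trans _ _ (lebesgue_measure ((U `&` `]-oo, (n%:R * h)%R[) `|`
   (`[(n%:R * h)%R, (n.+1%:R * h)%R[ : set R)))%E).
  rewrite measureU; [exact: leeD2r|exact: mI|exact: mC|].
  rewrite -subset0 => x /= [[_]]; rewrite ?in_itv /= => xh /andP[hx _].
  by move: (le_lt_trans hx xh); rewrite ltxx.
apply: le_measure; [apply/mem_set|exact: (mem_set (mI _))|].
  by apply: measurableU => //; exact: mI.
move=> x /= [[Ux]|]; rewrite ?in_itv /=.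
  by move=> /lt_le_trans xh; split=> //; exact: xh.
by move=> /andP[hx xh]; split=> //; exact: (Hb n).
Qed.

(** Outer regularity supplies the open set. Its measure is exposed only through the number of grid
    cells that it contains, which is what later bounds the number of covering discs. *)
Lemma negligible_open (R : realType) (T : set R) (eps : R) :
  (@lebesgue_measure R).-negligible T -> 0 < eps ->
  exists U : set R,
    [/\ (forall t, U t -> exists2 e, 0 < e & forall s, `|s - t| < e -> U s),
        T `<=` U &
        forall (h : R) (b : nat -> bool) n, 0 <= h ->
          (forall i, (i < n)%N -> b i ->
             forall t, i%:R * h <= t -> t < i.+1%:R * h -> U t) ->
          (\sum_(i < n) b i)%N%:R * h <= eps].
Proof.
move=> [B [mB B0 TB]] e0.
have [U [oU BU HU]] : exists U : set R,
    [/\ open U, B `<=` U & (lebesgue_measure (U `\` B) < eps%:E)%E].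
  have Boo : (lebesgue_measure B < +oo)%E by rewrite B0 ltry.
  exact: lebesgue_regularity_outer.
have mU : measurable U by exact: open_measurable.
exists U; split; last 1 first.
- move=> h b n h0 Hb; rewrite -lee_fin.
  apply: (le_trans (@grid_measure R U h b n oU h0 Hb)).
  have mI : measurable (U `&` `]-oo, (n%:R * h)[ : set R) by exact: measurableI.
  apply: (@le_trans _ _ (lebesgue_measure ((U `\` B) `|` B))%E).
    apply: le_measure; [exact/mem_set| |].
      by apply/mem_set/measurableU => //; exact: measurableD.
    move=> x [Ux _]; have [Bx|Bx] := pselect (B x); by [right|left].
  rewrite measureU//; last 2 first.
    exact: measurableD.
    by rewrite -subset0 => x [[_]].
  by rewrite [X in (_ + X <= _)%E]B0 adde0 ltW.
- move=> t Ut; have /nbhs_ballP[e /= e00 He] : nbhs t U by exact: open_nbhs_nbhs.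
  by exists e => // s; rewrite distrC => Hs; exact: He.
- exact: subset_trans BU.
Qed.

Import Rstruct Rstruct_topology.
Import Reals Lra.

(** The extra point [a] will be 2 PI: the null set consists of arguments in a half-open interval,
    whereas compactness is used on the closed one. *)
Lemma negligible_open_R (T : R -> Prop) (a eps : R) :
  (@lebesgue_measure R).-negligible [set t : R | T t] -> (0 < eps)%coqR ->
  exists U : R -> Prop,
    (forall t, U t -> exists e, (0 < e)%coqR /\ forall s, (Rabs (s - t) < e)%coqR -> U s) /\
    (forall t, T t \/ t = a -> U t) /\
    forall (h : R) (b : nat -> bool) n, (0 <= h)%coqR ->
      (forall i, (i < n)%coq_nat -> b i = true ->
         forall t, (INR i * h <= t < INR (S i) * h)%coqR -> U t) ->
      (INR (length (List.filter b (List.seq 0 n))) * h <= eps)%coqR.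
Proof.
move=> HT /RltP e0.
have Ha : (@lebesgue_measure R).-negligible [set a].
  by exists [set a]; split => //; exact: lebesgue_measure_set1.
have [U [oU TU HU]] := @negligible_open R _ eps (negligibleU HT Ha) e0.
exists U; split; [|split] => //.
- move=> t /oU [e e00 He]; exists e; split; first exact/RltP.
  by move=> s /RltP; rewrite RabsE => Hs; exact: He.
- move=> h b n /RleP h0 Hb; apply/RleP.
  have -> : length (List.filter b (List.seq 0 n)) = (\sum_(i < n) b i)%nat.
    elim: n {Hb} => [|n IH]; first by rewrite big_ord0.
    rewrite List.seq_S List.filter_app List.length_app IH big_ord_recr /=.
    by case: (b n).
  rewrite INRE; apply: HU => // i /ssrnat.ltP Hi bi t /RleP Ht1 /RltP Ht2.
  by apply: (Hb i Hi bi); rewrite !INRE.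
Qed.

(** * Clusters of a finite pseudometric space at scale r *)

Lemma components_label (n : nat) (dist : nat -> nat -> R) (r : R) :
  (forall i, dist i i = 0%coqR) -> (forall i j, dist i j = dist j i) ->
  (forall i j k, dist i k <= dist i j + dist j k)%coqR -> (0 <= r)%coqR ->
  exists lab : nat -> nat,
    (forall i, (i < n)%coq_nat -> (lab i < n)%coq_nat) /\
    forall i j, (i < n)%coq_nat -> (j < n)%coq_nat ->
      (lab i <> lab j -> (r <= dist i j)%coqR) /\
      (lab i = lab j -> (dist i j <= INR n * r)%coqR).
Proof.
move=> d0 dC dT r0.
case: n => [|n]; first by exists (fun i : nat => i); split=> [|i j] i0; inversion i0.
pose e : rel 'I_n.+1 := fun i j => if Rlt_dec (dist i j) r then true else false.
have eC : connect_sym e by apply: sym_connect_sym => i j; rewrite /e dC.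
exists (fun i => val (fingraph.root e (inord i))); split=> [i _|i j Hi Hj].
  exact/ssrnat.ltP/ltn_ord.
have vi : (inord i : 'I_n.+1) = i :> nat by apply: inordK; exact/ssrnat.ltP.
have vj : (inord j : 'I_n.+1) = j :> nat by apply: inordK; exact/ssrnat.ltP.
split=> [Hn|/val_inj Heq].
  apply: Rnot_lt_le => Hlt; apply: Hn; congr val.
  apply/(fingraph.rootP eC)/connect1; rewrite /e vi vj.
  by case: Rlt_dec.
have {Heq} /connectP[p] : connect e (inord i) (inord j) by exact/(fingraph.rootP eC).
(* A path without repeated vertices has fewer edges than there are points, and each edge is shorter
   than r; this bounds the diameter of a cluster. *)
move/shortenP => [q pq uq _] Hl.
have Hq : forall (x : 'I_n.+1) s, path e x s ->
    (dist x (last x s) <= INR (size s) * r)%coqR.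
  move=> x s; elim: s x => [|y s IH] x; first by rewrite /= d0 Rmult_0_l => _; exact: Rle_refl.
  cbn [path last size] => /andP[exy /IH Hs]; rewrite S_INR.
  have : (dist x y < r)%coqR by move: exy; rewrite /e; case: Rlt_dec.
  by move: (dT x y (last y s)) Hs; Lra.lra.
have := Hq _ _ pq; rewrite -Hl vi vj => H.
apply: (Rle_trans _ _ _ H); apply: Rmult_le_compat_r => //; apply: le_INR.
have := max_card (mem (inord i :: q)); rewrite (card_uniqP uq) card_ord /= => Hs.
by apply/ssrnat.leP; exact: ltnW.
Qed.
End Measure.

Require Import Defs.
From Stdlib Require Import Reals.
From Coquelicot Require Import Coquelicot.
From Stdlib Require Import Lra Lia List Classical ClassicalEpsilon.
Open Scope R_scope.

(** * Polynomials as coefficient lists *)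

Fixpoint padd (p q : list C) : list C :=
  match p, q with
  | nil, _ => q
  | _, nil => p
  | a :: p', b :: q' => Cplus a b :: padd p' q'
  end.

Definition pscal (c : C) (p : list C) : list C := map (Cmult c) p.

Definition psub (p q : list C) : list C := padd p (pscal (Copp (RtoC 1)) q).

Fixpoint pmul (p q : list C) : list C :=
  match p with
  | nil => nil
  | a :: p' => padd (pscal a q) (RtoC 0 :: pmul p' q)
  end.

Lemma eval_cons c p z : poly_eval (c :: p) z = (c + z * poly_eval p z)%C.
Proof. reflexivity. Qed.

Lemma eval_add p q z : poly_eval (padd p q) z = (poly_eval p z + poly_eval q z)%C.
Proof.
  revert q; induction p as [|a p IH]; intros [|b q]; simpl padd;
    rewrite ?eval_cons, ?IH; unfold poly_eval; simpl fold_right; ring.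
Qed.

Lemma eval_scal c p z : poly_eval (pscal c p) z = (c * poly_eval p z)%C.
Proof.
  induction p as [|a p IH].
  - unfold poly_eval; simpl; ring.
  - change (pscal c (a :: p)) with ((c * a)%C :: pscal c p).
    rewrite !eval_cons, IH. ring.
Qed.

Lemma eval_sub p q z : poly_eval (psub p q) z = (poly_eval p z - poly_eval q z)%C.
Proof. unfold psub; rewrite eval_add, eval_scal; ring. Qed.

Lemma eval_mul p q z : poly_eval (pmul p q) z = (poly_eval p z * poly_eval q z)%C.
Proof.
  induction p as [|a p IH]; simpl pmul.
  - unfold poly_eval; simpl; ring.
  - rewrite eval_add, eval_scal, !eval_cons, IH. ring.
Qed.

Lemma coef_add p q k : poly_coef (padd p q) k = (poly_coef p k + poly_coef q k)%C.
Proof.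
  unfold poly_coef; revert q k; induction p as [|a p IH]; intros [|b q] [|k]; simpl;
    rewrite ?IH; ring.
Qed.

Lemma coef_scal c p k : poly_coef (pscal c p) k = (c * poly_coef p k)%C.
Proof.
  unfold poly_coef, pscal; revert k; induction p as [|a p IH]; intros [|k]; simpl;
    rewrite ?IH; ring.
Qed.

Lemma coef_sub p q k : poly_coef (psub p q) k = (poly_coef p k - poly_coef q k)%C.
Proof. unfold psub; rewrite coef_add, coef_scal; ring. Qed.

(** The squared H^2 norm of a polynomial. *)
Definition psq (p : list C) : R := fold_right (fun c s => Cmod c ^ 2 + s) 0 p.

Lemma is_series_psq p : is_series (fun k => Cmod (poly_coef p k) ^ 2) (psq p).
Proof.
  induction p as [|c p IH].
  - unfold psq; simpl fold_right.
    apply is_series_ext with (fun _ => 0).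
    + intros n; unfold poly_coef; destruct n; simpl; rewrite Cmod_0; ring.
    + apply (filterlim_ext (fun _ => 0)).
      * intros n. rewrite sum_n_const. ring.
      * apply filterlim_const.
  - apply is_series_decr_1.
    unfold psq; simpl fold_right.
    replace (plus _ _) with (psq p); [exact IH|].
    unfold plus, opp, poly_coef; simpl. unfold psq. simpl. ring.
Qed.

Lemma psq_ge_0 p : 0 <= psq p.
Proof.
  induction p as [|c p IH]; [apply Rle_refl|].
  apply Rplus_le_le_0_compat; [apply pow2_ge_0|exact IH].
Qed.

(** * Discrete means over the roots of unity *)

Definition cis (t : R) : C := (cos t, sin t).

Lemma cis_plus s t : cis (s + t) = (cis s * cis t)%C.
Proof. unfold cis, Cmult; simpl; rewrite cos_plus, sin_plus; f_equal; ring. Qed.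

Lemma cis_0 : cis 0 = RtoC 1.
Proof. unfold cis; rewrite cos_0, sin_0; reflexivity. Qed.

Lemma cis_mod t : Cmod (cis t) = 1.
Proof.
  unfold Cmod, cis; simpl fst; simpl snd.
  replace (cos t ^ 2 + sin t ^ 2) with 1; [apply sqrt_1|].
  generalize (sin2_cos2 t); unfold Rsqr; intros; lra.
Qed.

Lemma cis_pow t n : (cis t ^ n)%C = cis (INR n * t).
Proof.
  induction n as [|n IH].
  - simpl; rewrite Rmult_0_l, cis_0; reflexivity.
  - rewrite Cpow_S, IH, <- cis_plus, S_INR; f_equal; ring.
Qed.

Lemma cis_neq_1 x : 0 < x < 2 * PI -> cis x <> RtoC 1.
Proof.
  intros Hx H.
  assert (Hc : cos x = 1) by exact (f_equal fst H).
  assert (Hs : 0 < sin (x / 2)) by (apply sin_gt_0; lra).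
  replace x with (2 * (x / 2)) in Hc by field.
  rewrite cos_2a_sin in Hc. nra.
Qed.

Lemma cis_2PI_nat n : cis (INR n * (2 * PI)) = RtoC 1.
Proof.
  rewrite <- cis_pow.
  replace (cis (2 * PI)) with (RtoC 1); [apply Cpow_1_l|].
  unfold cis; rewrite cos_2PI, sin_2PI; reflexivity.
Qed.

Fixpoint csum (u : nat -> C) (n : nat) : C :=
  match n with O => RtoC 0 | S m => (csum u m + u m)%C end.

Lemma csum_ext u v n : (forall k, (k < n)%nat -> u k = v k) -> csum u n = csum v n.
Proof.
  induction n as [|n IH]; intros H; simpl; [reflexivity|].
  rewrite IH by (intros; apply H; lia). rewrite H by lia. reflexivity.
Qed.

Lemma csum_plus u v n : csum (fun k => u k + v k)%C n = (csum u n + csum v n)%C.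
Proof. induction n as [|n IH]; simpl; rewrite ?IH; ring. Qed.

Lemma csum_scal c u n : csum (fun k => c * u k)%C n = (c * csum u n)%C.
Proof. induction n as [|n IH]; simpl; rewrite ?IH; ring. Qed.

Lemma csum_conj u n : csum (fun k => Cconj (u k)) n = Cconj (csum u n).
Proof.
  induction n as [|n IH]; simpl; rewrite ?IH, ?Cplus_conj; [|reflexivity].
  unfold Cconj, RtoC; simpl; f_equal; ring.
Qed.

Lemma csum_const c n : csum (fun _ => c) n = (RtoC (INR n) * c)%C.
Proof.
  induction n as [|n IH]; [simpl; ring|].
  rewrite S_INR, RtoC_plus; simpl csum; rewrite IH; ring.
Qed.

Lemma csum_re_le u v n :
  (forall k, (k < n)%nat -> Re (u k) <= Re (v k)) -> Re (csum u n) <= Re (csum v n).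
Proof.
  induction n as [|n IH]; intros H; simpl; [lra|].
  assert (H1 : Re (csum u n) <= Re (csum v n)) by (apply IH; intros; apply H; lia).
  assert (H2 := H n ltac:(lia)).
  unfold Re in *; simpl; lra.
Qed.

Lemma csum_geom x n : ((x - 1) * csum (fun k => x ^ k) n = x ^ n - 1)%C.
Proof.
  induction n as [|n IH]; simpl csum; [simpl; ring|].
  rewrite Cmult_plus_distr_l, IH, Cpow_S; ring.
Qed.

Section RootsOfUnity.

Variable N : nat.
Let w (j : nat) : C := (cis (2 * PI / INR N) ^ j)%C.

(** Since 0 < d < N, the number x = cis (2 PI / N)^d differs from 1 while x^N = 1, so its geometric
    sum vanishes. *)
Lemma csum_root_pow d : (0 < d < N)%nat -> csum (fun j => w j ^ d)%C N = RtoC 0.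
Proof.
  intros Hd. set (x := cis (INR d * (2 * PI / INR N))).
  assert (HN : 0 < INR N) by (apply lt_0_INR; lia).
  assert (Hx : x <> RtoC 1).
  { apply cis_neq_1. generalize PI_RGT_0; intros HP.
    assert (0 < INR d < INR N) by (split; [apply lt_0_INR|apply lt_INR]; lia).
    replace (INR d * (2 * PI / INR N)) with (2 * PI * (INR d / INR N)) by (field; lra).
    assert (0 < INR d / INR N) by (apply Rdiv_lt_0_compat; lra).
    assert (INR d / INR N < 1) by (apply Rlt_div_l; lra).
    split; nra. }
  rewrite (csum_ext _ (fun j => x ^ j)%C).
  - assert (Hg := csum_geom x N).
    replace (x ^ N)%C with (RtoC 1) in Hg.
    + replace (1 - 1)%C with (RtoC 0) in Hg by ring.
      destruct (Ceq_dec (csum (fun k => x ^ k)%C N) (RtoC 0)) as [H|H]; [exact H|].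
      exfalso. revert Hg. apply Cmult_neq_0; [|exact H].
      intros H'. apply Hx. replace x with ((x - 1) + 1)%C by ring. rewrite H'; ring.
    + unfold x; rewrite cis_pow.
      replace (INR N * (INR d * (2 * PI / INR N))) with (INR d * (2 * PI)) by (field; lra).
      now rewrite cis_2PI_nat.
  - intros j _. unfold w, x. rewrite !cis_pow. f_equal. ring.
Qed.

(** The exponents in z^d p(z) lie strictly between 0 and N, so every monomial averages to 0. *)
Lemma csum_root_shift p d :
  (0 < d)%nat -> (d + length p <= N)%nat ->
  csum (fun j => w j ^ d * poly_eval p (w j))%C N = RtoC 0.
Proof.
  revert d; induction p as [|c p IH]; intros d Hd Hl; simpl in Hl.
  - rewrite (csum_ext _ (fun _ => RtoC 0)); [rewrite csum_const; ring|].
    intros; unfold poly_eval; simpl; ring.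
  - rewrite (csum_ext _ (fun j => c * w j ^ d + w j ^ S d * poly_eval p (w j))%C).
    + rewrite csum_plus, csum_scal, csum_root_pow, IH by lia. ring.
    + intros j _. rewrite eval_cons, Cpow_S. ring.
Qed.

Lemma mean_eval p :
  (length p <= N)%nat ->
  csum (fun j => poly_eval p (w j)) N = (RtoC (INR N) * poly_eval p (RtoC 0))%C.
Proof.
  destruct p as [|c p]; intros Hl; simpl in Hl.
  - exact (csum_const (RtoC 0) N).
  - rewrite (csum_ext _ (fun j => c + w j ^ 1 * poly_eval p (w j))%C).
    + rewrite csum_plus, csum_const, csum_root_shift by lia. rewrite eval_cons. ring.
    + intros j _. rewrite eval_cons, Cpow_1_r. reflexivity.
Qed.

Lemma root_mod j : Cmod (w j) = 1.
Proof. unfold w; rewrite cis_pow; apply cis_mod. Qed.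

(** Expand |c + w b|^2 with |w| = 1 and b the value of the tail polynomial: the cross terms come
    from w b, which has no constant term and averages to 0. *)
Lemma parseval p :
  (length p <= N)%nat ->
  csum (fun j => RtoC (Cmod (poly_eval p (w j)) ^ 2)) N = RtoC (INR N * psq p).
Proof.
  induction p as [|c p IH]; intros Hl.
  - rewrite (csum_ext _ (fun _ => RtoC 0)).
    + rewrite csum_const. unfold psq; simpl. rewrite Rmult_0_r; ring.
    + intros; unfold poly_eval; simpl; rewrite Cmod_0. f_equal; ring.
  - simpl in Hl.
    set (u := fun j => (w j ^ 1 * poly_eval p (w j))%C).
    rewrite (csum_ext _ (fun j => RtoC (Cmod c ^ 2) +
       (RtoC (Cmod (poly_eval p (w j)) ^ 2) + (Cconj c * u j + c * Cconj (u j))))%C).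
    + rewrite !csum_plus, !csum_scal, csum_conj, csum_const, IH by lia.
      unfold u; rewrite csum_root_shift by lia.
      change (psq (c :: p)) with (Cmod c ^ 2 + psq p).
      replace (Cconj (RtoC 0)) with (RtoC 0) by (unfold Cconj, RtoC; simpl; f_equal; ring).
      rewrite !RtoC_mult, RtoC_plus. ring.
    + intros j _. unfold u.
      rewrite Cpow_1_r, eval_cons. rewrite !Cmod2_conj, Cplus_conj, !Cmult_conj.
      assert (Hw : (w j * Cconj (w j))%C = RtoC 1)
        by (rewrite <- Cmod2_conj, root_mod; f_equal; ring).
      set (b := poly_eval p (w j)).
      replace (b * Cconj b)%C with ((w j * Cconj (w j)) * (b * Cconj b))%C
        by (rewrite Hw; ring).
      ring.
Qed.

End RootsOfUnity.

(** The passage from pointwise bounds on the circle to sums over coefficients. With N larger than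
    all four lengths every average is exact. The general right-hand side serves both the triangle
    inequality and the bound of |phi|^2 by Re phi. *)
Lemma psq_le (D A B phi : list C) (a b e : R) :
  (forall z, Cmod z = 1 ->
    Cmod (poly_eval D z) ^ 2 <=
    a * Cmod (poly_eval A z) ^ 2 + b * Cmod (poly_eval B z) ^ 2
    + Re (poly_eval phi z) + e) ->
  psq D <= a * psq A + b * psq B + Re (poly_eval phi (RtoC 0)) + e.
Proof.
  intros H.
  set (N := S (length D + length A + length B + length phi)).
  set (w := fun j => (cis (2 * PI / INR N) ^ j)%C).
  assert (HN : 0 < INR N) by (apply lt_0_INR; unfold N; lia).
  assert (HD := parseval N D ltac:(unfold N; lia)).
  assert (HA := parseval N A ltac:(unfold N; lia)).
  assert (HB := parseval N B ltac:(unfold N; lia)).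
  assert (Hp := mean_eval N phi ltac:(unfold N; lia)).
  fold w in HD, HA, HB, Hp.
  assert (HH : Re (csum (fun j => RtoC (Cmod (poly_eval D (w j)) ^ 2)) N) <=
    Re (csum (fun j => RtoC a * RtoC (Cmod (poly_eval A (w j)) ^ 2) +
                      (RtoC b * RtoC (Cmod (poly_eval B (w j)) ^ 2) +
                      (poly_eval phi (w j) + RtoC e)))%C N)).
  { apply csum_re_le. intros j _.
    assert (Hj := H (w j) (root_mod N j)).
    unfold Re in *; simpl in *. lra. }
  rewrite !csum_plus, !csum_scal, csum_const, HA, HB, HD, Hp in HH.
  apply Rmult_le_reg_l with (INR N); [exact HN|].
  unfold Re in *; simpl in *. lra.
Qed.

(** * Uniform limits of polynomials on the closed disc *)

(** The disc algebra, described by polynomial approximation so that a rational function with poles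
    off the closed disc can be traded for a polynomial. *)
Definition disc_limit (F : C -> C) : Prop :=
  forall eps, 0 < eps ->
  exists p, forall z, Cmod z <= 1 -> Cmod (poly_eval p z - F z)%C <= eps.

Lemma poly_bound p : exists M, 0 < M /\ forall z, Cmod z <= 1 -> Cmod (poly_eval p z) <= M.
Proof.
  induction p as [|c p [M [HM H]]].
  - exists 1. split; [lra|]. intros z _. unfold poly_eval; simpl. rewrite Cmod_0; lra.
  - exists (Cmod c + M). assert (Hc := Cmod_ge_0 c). split; [lra|]. intros z Hz.
    rewrite eval_cons. eapply Rle_trans; [apply Cmod_triangle|].
    rewrite Cmod_mult. assert (H1 := H z Hz). assert (H2 := Cmod_ge_0 z).
    assert (H3 := Cmod_ge_0 (poly_eval p z)). nra.
Qed.

Lemma Cmod_le_minus x y e : Cmod (x - y)%C <= e -> Cmod x <= Cmod y + e.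
Proof.
  intros H. replace x with (y + (x - y))%C by ring.
  eapply Rle_trans; [apply Cmod_triangle|]. lra.
Qed.

Lemma Cmod_minus_sym x y : Cmod (x - y)%C = Cmod (y - x)%C.
Proof. rewrite <- Cmod_opp. f_equal; ring. Qed.

Lemma Cmod_minus_ge x y : Cmod x - Cmod y <= Cmod (x - y)%C.
Proof. assert (H := Cmod_le_minus x y _ (Rle_refl _)). lra. Qed.

Lemma disc_limit_bound F : disc_limit F ->
  exists M, 0 < M /\ forall z, Cmod z <= 1 -> Cmod (F z) <= M.
Proof.
  intros H. destruct (H 1 Rlt_0_1) as [p Hp]. destruct (poly_bound p) as [M [HM Hb]].
  exists (M + 1). split; [lra|]. intros z Hz.
  assert (H1 := Hp z Hz). rewrite Cmod_minus_sym in H1.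
  apply Cmod_le_minus in H1. assert (H2 := Hb z Hz). lra.
Qed.

Lemma disc_limit_poly p : disc_limit (poly_eval p).
Proof.
  intros e He. exists p. intros z _.
  replace (poly_eval p z - poly_eval p z)%C with (RtoC 0) by ring. rewrite Cmod_0; lra.
Qed.

Lemma disc_limit_closed F :
  (forall eps, 0 < eps -> exists F', disc_limit F' /\
     forall z, Cmod z <= 1 -> Cmod (F' z - F z)%C <= eps) -> disc_limit F.
Proof.
  intros H e He. destruct (H (e / 2) ltac:(lra)) as [F' [HF' Hc]].
  destruct (HF' (e / 2) ltac:(lra)) as [p Hp]. exists p. intros z Hz.
  replace (poly_eval p z - F z)%C with ((poly_eval p z - F' z) + (F' z - F z))%C by ring.
  eapply Rle_trans; [apply Cmod_triangle|].
  assert (H1 := Hp z Hz). assert (H2 := Hc z Hz). lra.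
Qed.

Lemma disc_limit_ext F G :
  (forall z, Cmod z <= 1 -> F z = G z) -> disc_limit F -> disc_limit G.
Proof.
  intros H HF e He. destruct (HF e He) as [p Hp]. exists p. intros z Hz.
  rewrite <- H by exact Hz. now apply Hp.
Qed.

Lemma disc_limit_const c : disc_limit (fun _ => c).
Proof.
  apply disc_limit_ext with (poly_eval (c :: nil)); [|apply disc_limit_poly].
  intros z _. unfold poly_eval; simpl; ring.
Qed.

Lemma disc_limit_id : disc_limit (fun z => z).
Proof.
  apply disc_limit_ext with (poly_eval (RtoC 0 :: RtoC 1 :: nil)); [|apply disc_limit_poly].
  intros z _. unfold poly_eval; simpl; ring.
Qed.

Lemma disc_limit_plus F G :
  disc_limit F -> disc_limit G -> disc_limit (fun z => F z + G z)%C.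
Proof.
  intros HF HG e He. destruct (HF (e / 2) ltac:(lra)) as [p Hp].
  destruct (HG (e / 2) ltac:(lra)) as [q Hq]. exists (padd p q). intros z Hz.
  rewrite eval_add.
  replace (poly_eval p z + poly_eval q z - (F z + G z))%C
    with ((poly_eval p z - F z) + (poly_eval q z - G z))%C by ring.
  eapply Rle_trans; [apply Cmod_triangle|].
  assert (H1 := Hp z Hz). assert (H2 := Hq z Hz). lra.
Qed.

Lemma disc_limit_mult F G :
  disc_limit F -> disc_limit G -> disc_limit (fun z => F z * G z)%C.
Proof.
  intros HF HG e He. destruct (disc_limit_bound G HG) as [M [HM Hb]].
  destruct (HF (e / 2 / M)) as [p Hp]. { apply Rdiv_lt_0_compat; lra. }
  destruct (poly_bound p) as [K [HK Hpb]].
  (* [q] is chosen after [p], because its accuracy depends on the bound [K] for [p]. *)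
  destruct (HG (e / 2 / K)) as [q Hq]. { apply Rdiv_lt_0_compat; lra. }
  exists (pmul p q). intros z Hz. rewrite eval_mul.
  replace (poly_eval p z * poly_eval q z - F z * G z)%C
    with (poly_eval p z * (poly_eval q z - G z) + (poly_eval p z - F z) * G z)%C by ring.
  eapply Rle_trans; [apply Cmod_triangle|]. rewrite !Cmod_mult.
  replace e with (K * (e / 2 / K) + e / 2 / M * M) by (field; lra).
  apply Rplus_le_compat; apply Rmult_le_compat; auto using Cmod_ge_0.
Qed.

Lemma disc_limit_pow F n : disc_limit F -> disc_limit (fun z => F z ^ n)%C.
Proof.
  intros HF. induction n as [|n IH]; [exact (disc_limit_const (RtoC 1))|].
  apply disc_limit_ext with (fun z => F z * F z ^ n)%C.
  - intros; now rewrite Cpow_S.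
  - now apply disc_limit_mult.
Qed.

Lemma disc_limit_csum (F : nat -> C -> C) n :
  (forall k, disc_limit (F k)) -> disc_limit (fun z => csum (fun k => F k z) n).
Proof.
  intros HF. induction n as [|n IH]; simpl; [apply disc_limit_const|].
  now apply disc_limit_plus.
Qed.

Lemma Re_le_Cmod x : Re x <= Cmod x.
Proof. eapply Rle_trans; [apply Rle_abs|apply re_le_Cmod]. Qed.

Lemma Cmod_pos_of_Re x : 0 < Re x -> x <> RtoC 0.
Proof. intros H E. rewrite E in H. unfold Re in H; simpl in H. lra. Qed.

Lemma Cmod_sq x : Cmod x ^ 2 = fst x ^ 2 + snd x ^ 2.
Proof. exact (Cmod2_alt x). Qed.

Lemma Cmod_le_sq x r : 0 <= r -> fst x ^ 2 + snd x ^ 2 <= r ^ 2 -> Cmod x <= r.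
Proof.
  intros Hr H. rewrite <- Cmod_sq in H. assert (H1 := Cmod_ge_0 x).
  apply Rsqr_incr_0; unfold Rsqr; lra.
Qed.

(* For small t > 0 the values of 1 - tF stay in a disc of radius < 1, so
   1/F = t (1 + (1 - tF) + (1 - tF)^2 + ...) uniformly. *)
Lemma disc_limit_inv F c :
  disc_limit F -> 0 < c -> (forall z, Cmod z <= 1 -> c <= Re (F z)) ->
  disc_limit (fun z => / F z)%C.
Proof.
  intros HF Hc HR. destruct (disc_limit_bound F HF) as [M [HM Hb]].
  assert (HcM : c <= M).
  { eapply Rle_trans; [apply (HR (RtoC 0)); rewrite Cmod_0; lra|].
    eapply Rle_trans; [apply Re_le_Cmod|]. apply Hb; rewrite Cmod_0; lra. }
  (* |1 - t F|^2 <= 1 - 2 t c + t^2 M^2, and this [t] minimizes the right side, with value 1 - t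
     c. *)
  set (t := c / M ^ 2).
  assert (HM2 : 0 < M ^ 2) by nra.
  assert (Ht : 0 < t) by (apply Rdiv_lt_0_compat; lra).
  assert (HtM : t * M ^ 2 = c) by (unfold t; field; lra).
  assert (Htc : t * c <= 1) by (unfold t; apply Rmult_le_reg_r with (M ^ 2); [lra|];
    replace (c / M ^ 2 * c * M ^ 2) with (c * c) by (field; lra); nra).
  assert (Htc0 : 0 < t * c) by nra.
  set (rho := sqrt (1 - t * c)).
  assert (Hrho0 : 0 <= rho) by apply sqrt_pos.
  assert (Hrho2 : rho ^ 2 = 1 - t * c) by (apply pow2_sqrt; lra).
  assert (Hrho1 : rho < 1) by nra.
  set (X := fun z => (1 - RtoC t * F z)%C).
  assert (HX : forall z, Cmod z <= 1 -> Cmod (X z) <= rho).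
  { intros z Hz. apply Cmod_le_sq; [exact Hrho0|]. rewrite Hrho2.
    assert (H1 := HR z Hz). assert (H2 := Hb z Hz). assert (H3 := Cmod_ge_0 (F z)).
    assert (H4 : Cmod (F z) ^ 2 <= M ^ 2) by (apply pow_incr; lra).
    rewrite Cmod_sq in H4. unfold X, Re in *.
    replace (fst (1 - t * F z)%C ^ 2 + snd (1 - t * F z)%C ^ 2)
      with (1 - 2 * t * fst (F z) + t * (t * (fst (F z) ^ 2 + snd (F z) ^ 2)))
      by (simpl; ring).
    assert (t * (fst (F z) ^ 2 + snd (F z) ^ 2) <= c) by (rewrite <- HtM; nra).
    nra. }
  apply disc_limit_closed. intros e He.
  destruct (pow_lt_1_zero rho ltac:(rewrite Rabs_pos_eq; lra) (e * c) ltac:(nra)) as [n Hn].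
  exists (fun z => RtoC t * csum (fun k => X z ^ k) n)%C. split.
  - apply disc_limit_mult; [apply disc_limit_const|].
    apply (disc_limit_csum (fun k z => X z ^ k)%C). intros k. apply disc_limit_pow.
    apply disc_limit_plus; [apply disc_limit_const|].
    apply disc_limit_ext with (fun z => RtoC (- t) * F z)%C.
    + intros; rewrite RtoC_opp; ring.
    + apply disc_limit_mult; [apply disc_limit_const|exact HF].
  - intros z Hz. assert (HFz := HR z Hz).
    assert (HF0 : F z <> RtoC 0) by (apply Cmod_pos_of_Re; lra).
    assert (Hg := csum_geom (X z) n).
    replace (RtoC t * csum (fun k => X z ^ k) n - / F z)%C with (- (X z ^ n) / F z)%C.
    + rewrite Cmod_div, Cmod_opp, Cmod_pow by exact HF0.
      assert (Hp : Cmod (X z) ^ n <= rho ^ n)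
        by (apply pow_incr; split; [apply Cmod_ge_0|now apply HX]).
      assert (Hn' := Hn n (Nat.le_refl n)).
      rewrite Rabs_pos_eq in Hn' by now apply pow_le.
      assert (Hm := Re_le_Cmod (F z)).
      apply Rle_div_l; [lra|]. nra.
    + apply (f_equal (fun y => y / F z)%C) in Hg.
      transitivity ((X z - 1) * csum (fun k => X z ^ k) n / F z * (-1) - / F z)%C.
      * rewrite Hg. field. exact HF0.
      * unfold X at 1. field. exact HF0.
Qed.

(** * Peak polynomials *)

Definition covers (L : list C) (d : R) (A : C -> Prop) : Prop :=
  forall z, A z -> exists c, In c L /\ Cmod (z - c)%C <= d.

(** All discs share one radius, so this says that the one-dimensional Minkowski content is zero. For
    closed sets it follows from measure zero. *)
Definition small_covers (A : C -> Prop) : Prop :=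
  forall eps, 0 < eps -> exists L d, 0 < d /\ INR (length L) * d <= eps /\
    (forall c, In c L -> Cmod c = 1) /\ covers L d A.

(** The pole (1 + d) c lies just outside the disc; the value at c is 1, and away from c the modulus
    is of order d / |z - c|. *)
Definition kern (d : R) (c z : C) : C := (RtoC d / (RtoC (1 + d) - Cconj c * z))%C.

Fixpoint kern_sum (L : list C) (d : R) (z : C) : C :=
  match L with nil => RtoC 0 | c :: L' => (kern d c z + kern_sum L' d z)%C end.

Section Kernel.

Variables (d : R) (c : C).
Hypotheses (Hd : 0 < d) (Hc : Cmod c = 1).

Lemma Re_kern_denom z : Cmod z <= 1 -> d <= Re (RtoC (1 + d) - Cconj c * z)%C.
Proof.
  intros Hz.
  assert (H := Re_le_Cmod (Cconj c * z)%C).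
  rewrite Cmod_mult, Cmod_conj, Hc in H. unfold Re in *; simpl in *. lra.
Qed.

Lemma kern_denom_neq_0 z : Cmod z <= 1 -> (RtoC (1 + d) - Cconj c * z)%C <> RtoC 0.
Proof. intros Hz. apply Cmod_pos_of_Re. assert (H := Re_kern_denom z Hz). lra. Qed.

Lemma Cmod_1_conj z : Cmod (1 - Cconj c * z)%C = Cmod (z - c)%C.
Proof.
  rewrite (Cmod_minus_sym z).
  replace (1 - Cconj c * z)%C with (Cconj c * (c - z))%C.
  - rewrite Cmod_mult, Cmod_conj, Hc. ring.
  - assert (H := Cmod2_conj c). rewrite Hc in H.
    replace (RtoC (1 ^ 2)) with (RtoC 1) in H by (f_equal; ring). rewrite H. ring.
Qed.

Lemma disc_limit_kern : disc_limit (kern d c).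
Proof.
  apply disc_limit_mult; [apply disc_limit_const|].
  apply disc_limit_inv with d; [|exact Hd|apply Re_kern_denom].
  apply disc_limit_plus; [apply disc_limit_const|].
  apply disc_limit_ext with (fun z => (- Cconj c) * z)%C; [intros; ring|].
  apply disc_limit_mult; [apply disc_limit_const|apply disc_limit_id].
Qed.

Lemma Re_kern z :
  Re (kern d c z) = d * (Re (RtoC (1 + d) - Cconj c * z)%C /
                         Cmod (RtoC (1 + d) - Cconj c * z)%C ^ 2).
Proof.
  unfold kern. rewrite Cmod_sq. set (D := (RtoC (1 + d) - Cconj c * z)%C).
  unfold Re, Cdiv, Cinv; simpl. ring.
Qed.

Lemma Re_kern_ge_0 z : Cmod z <= 1 -> 0 <= Re (kern d c z).
Proof.
  intros Hz. rewrite Re_kern. assert (H := Re_kern_denom z Hz).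
  assert (H0 := proj1 (Cmod_gt_0 _) (kern_denom_neq_0 z Hz)).
  apply Rmult_le_pos; [lra|]. apply Rdiv_le_0_compat; [lra|]. apply pow_lt, H0.
Qed.

(** The denominator D has Re D >= d and |D| <= 2 d, so d Re D / |D|^2 is at least 1/4. *)
Lemma Re_kern_near z : Cmod z <= 1 -> Cmod (z - c)%C <= d -> 1 / 4 <= Re (kern d c z).
Proof.
  intros Hz Hn. rewrite Re_kern. assert (H := Re_kern_denom z Hz).
  assert (H0 := proj1 (Cmod_gt_0 _) (kern_denom_neq_0 z Hz)).
  set (D := (RtoC (1 + d) - Cconj c * z)%C) in *.
  assert (HD : Cmod D <= 2 * d).
  { replace D with (RtoC d + (1 - Cconj c * z))%C by (unfold D; rewrite RtoC_plus; ring).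
    eapply Rle_trans; [apply Cmod_triangle|].
    rewrite Cmod_1_conj, Cmod_R, Rabs_pos_eq by lra. lra. }
  assert (HD2 : Cmod D ^ 2 <= 4 * d ^ 2) by nra.
  assert (0 < Cmod D ^ 2) by (apply pow_lt; exact H0).
  assert (d * d <= d * Re D) by (apply Rmult_le_compat_l; lra).
  replace (d * (Re D / Cmod D ^ 2)) with (d * Re D / Cmod D ^ 2) by (field; lra).
  apply (Rle_div_r (1 / 4)); [lra|]. replace (d ^ 2) with (d * d) in HD2 by ring. lra.
Qed.

Lemma Cmod_kern_far z r :
  Cmod z <= 1 -> 0 < r -> d + r <= Cmod (z - c)%C -> Cmod (kern d c z) <= d / r.
Proof.
  intros Hz Hr Hf.
  unfold kern. rewrite Cmod_div, Cmod_R, Rabs_pos_eq by (try lra; now apply kern_denom_neq_0).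
  apply Rmult_le_compat_l; [lra|]. apply Rinv_le_contravar; [exact Hr|].
  rewrite <- Cmod_1_conj in Hf.
  replace (RtoC (1 + d) - Cconj c * z)%C with ((1 - Cconj c * z) - RtoC (- d))%C
    by (rewrite RtoC_plus, RtoC_opp; ring).
  eapply Rle_trans; [|apply Cmod_minus_ge].
  rewrite Cmod_R, Rabs_Ropp, Rabs_pos_eq by lra. lra.
Qed.

Lemma Cmod_kern_0 : Cmod (kern d c (RtoC 0)) <= d.
Proof.
  unfold kern. rewrite Cmult_0_r. unfold Cminus.
  replace (RtoC (1 + d) + - 0)%C with (RtoC (1 + d)) by ring.
  rewrite Cmod_div by (apply Cmod_pos_of_Re; unfold Re; simpl; lra).
  rewrite !Cmod_R, !Rabs_pos_eq by lra.
  apply Rle_div_l; nra.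
Qed.

End Kernel.

Section KernelSum.

Variable d : R.
Hypothesis Hd : 0 < d.

Lemma disc_limit_kern_sum L : (forall c, In c L -> Cmod c = 1) -> disc_limit (kern_sum L d).
Proof.
  induction L as [|c L IH]; intros HL; [exact (disc_limit_const (RtoC 0))|].
  apply disc_limit_plus; [apply disc_limit_kern; [exact Hd|apply HL; now left]|].
  apply IH. intros; apply HL; now right.
Qed.

Lemma Re_kern_sum_ge_0 L z :
  (forall c, In c L -> Cmod c = 1) -> Cmod z <= 1 -> 0 <= Re (kern_sum L d z).
Proof.
  intros HL Hz. induction L as [|c L IH]; [apply Rle_refl|].
  apply Rplus_le_le_0_compat.
  - apply Re_kern_ge_0; auto. apply HL; now left.
  - apply IH. intros; apply HL; now right.
Qed.

Lemma Re_kern_sum_near L z c :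
  (forall c, In c L -> Cmod c = 1) -> Cmod z <= 1 ->
  In c L -> Cmod (z - c)%C <= d -> 1 / 4 <= Re (kern_sum L d z).
Proof.
  intros HL Hz. induction L as [|b L IH]; intros Hin Hn; [destruct Hin|].
  change (1 / 4 <= Re (kern d b z) + Re (kern_sum L d z)).
  assert (HL' : forall c, In c L -> Cmod c = 1) by (intros; apply HL; now right).
  assert (Hb := HL b (or_introl eq_refl)).
  destruct Hin as [<-|Hin].
  - assert (H := Re_kern_near d b Hd Hb z Hz Hn).
    assert (H1 := Re_kern_sum_ge_0 L z HL' Hz). lra.
  - assert (H := Re_kern_ge_0 d b Hd Hb z Hz).
    assert (H1 := IH HL' Hin Hn). lra.
Qed.

Lemma Cmod_kern_sum_le L z r :
  (forall c, In c L -> Cmod (kern d c z) <= r) ->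
  Cmod (kern_sum L d z) <= INR (length L) * r.
Proof.
  induction L as [|c L IH]; intros H.
  - simpl. rewrite Cmod_0. lra.
  - change (length (c :: L)) with (S (length L)). rewrite S_INR. simpl kern_sum.
    eapply Rle_trans; [apply Cmod_triangle|].
    assert (H1 := H c (or_introl eq_refl)).
    assert (H2 := IH (fun c H' => H c (or_intror H'))). lra.
Qed.

End KernelSum.

Lemma list_select (P : C -> Prop) (L : list C) :
  exists L', (length L' <= length L)%nat /\
    forall c, In c L' <-> In c L /\ P c.
Proof.
  induction L as [|a L [L' [Hl HI]]].
  - exists nil. simpl. intuition.
  - destruct (classic (P a)) as [Ha|Ha].
    + exists (a :: L'). simpl. split; [lia|]. intros c. rewrite HI.
      intuition; subst; auto.
    + exists L'. simpl. split; [lia|]. intros c. rewrite HI.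
      intuition; subst; tauto.
Qed.

(* 1 - 1/(1+W) = W/(1+W), and this Moebius map sends the right half-plane onto the disc
   with diameter [0,1]. *)
Lemma Cmod_mobius_half (W : C) :
  0 <= Re W -> Cmod (1 - / (1 + W) - / 2)%C <= / 2.
Proof.
  intros H.
  assert (H1 : (1 + W)%C <> RtoC 0) by (apply Cmod_pos_of_Re; unfold Re in *; simpl; lra).
  replace (1 - / (1 + W) - / 2)%C with ((W - 1) / (2 * (1 + W)))%C.
  2:{ field. exact H1. }
  rewrite Cmod_div, Cmod_mult, (Cmod_R 2), Rabs_pos_eq.
  2: lra. 2: { apply Cmult_neq_0; auto. apply Cmod_pos_of_Re; unfold Re; simpl; lra. }
  assert (H2 := proj1 (Cmod_gt_0 _) H1).
  apply Rle_div_l; [lra|].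
  replace (/ 2 * (2 * Cmod (1 + W))) with (Cmod (1 + W)) by field.
  apply Cmod_le_sq; [lra|]. rewrite Cmod_sq. unfold Re in H; simpl. nra.
Qed.

Lemma peak_poly (A F : C -> Prop) (r eps : R) :
  small_covers A -> (forall z, A z -> Cmod z <= 1) -> (forall z, F z -> Cmod z <= 1) ->
  0 < r -> (forall a z, A a -> F z -> r <= Cmod (z - a)%C) -> 0 < eps ->
  exists phi,
    (forall z, Cmod z <= 1 -> Cmod (poly_eval phi z - / 2)%C <= / 2 + eps) /\
    (forall z, A z -> Cmod (poly_eval phi z - 1)%C <= eps) /\
    (forall z, F z -> Cmod (poly_eval phi z) <= eps) /\
    Cmod (poly_eval phi (RtoC 0)) <= eps.
Proof.
  intros Hcov HA HF Hr Hsep He.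
  (* On [A] the real part of [W] is at least N / 4 = 2 / eps, so 1 / |1 + W| <= eps / 2; the other
     half of eps pays for the polynomial approximation. *)
  set (N := 8 / eps). assert (HN : 0 < N) by (apply Rdiv_lt_0_compat; lra).
  assert (HNe : N * eps = 8) by (unfold N; field; lra).
  (* The first bound keeps the discs small against the separation, the second makes [W] small at 0,
     and the third makes it small on [F], where each kernel is at most d / (r / 2). *)
  set (e' := Rmin (r / 4) (Rmin (eps / 2 / N) (eps / 2 / N * (r / 2)))).
  assert (HeN : 0 < eps / 2 / N) by (apply Rdiv_lt_0_compat; lra).
  assert (He' : 0 < e').
  { unfold e'; repeat apply Rmin_glb_lt; try lra. apply Rmult_lt_0_compat; lra. }
  assert (He1 : e' <= r / 4) by apply Rmin_l.
  assert (He2 : e' <= eps / 2 / N) by (eapply Rle_trans; [apply Rmin_r|apply Rmin_l]).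
  assert (He3 : e' <= eps / 2 / N * (r / 2))
    by (eapply Rle_trans; [apply Rmin_r|apply Rmin_r]).
  destruct (Hcov e' He') as [L0 [d [Hd [Hld [HL0 HcL0]]]]].
  (* Discs that miss [A] are dropped; the remaining centers are within d of [A], hence far from
     [F]. *)
  destruct (list_select (fun c => exists a, A a /\ Cmod (a - c)%C <= d) L0)
    as [L [Hlen HL']].
  assert (HL : forall c, In c L -> Cmod c = 1) by (intros c Hin; apply HL0, HL', Hin).
  assert (HlenR : INR (length L) <= INR (length L0)) by now apply le_INR.
  assert (HlL : INR (length L) * d <= e') by nra.
  (* A bound on the total length controls d only when the list is nonempty, hence the membership
     premise. *)
  assert (Hdr : forall c, In c L -> d <= r / 4).
  { intros c Hin. destruct L as [|b L]; [destruct Hin|].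
    change (length (b :: L)) with (S (length L)) in HlL. rewrite S_INR in HlL.
    assert (H := pos_INR (length L)). nra. }
  set (W := fun z => (RtoC N * kern_sum L d z)%C).
  assert (HReW : forall z, Re (W z) = N * Re (kern_sum L d z))
    by (intros; unfold W, Re; simpl; ring).
  assert (HW : forall z, Cmod z <= 1 -> 0 <= Re (W z)).
  { intros z Hz. rewrite HReW. apply Rmult_le_pos; [lra|]. now apply Re_kern_sum_ge_0. }
  assert (HmW : forall z, Cmod (W z) = N * Cmod (kern_sum L d z)).
  { intros z. unfold W. rewrite Cmod_mult, Cmod_R, Rabs_pos_eq by lra. reflexivity. }
  set (Phi := fun z => (1 - / (1 + W z))%C).
  assert (HPhi : disc_limit Phi).
  { apply disc_limit_plus; [apply disc_limit_const|].
    apply disc_limit_ext with (fun z => - (1) * / (1 + W z))%C; [intros; ring|].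
    apply disc_limit_mult; [apply disc_limit_const|].
    apply disc_limit_inv with 1; [|lra|].
    - apply disc_limit_plus; [apply disc_limit_const|].
      apply disc_limit_mult; [apply disc_limit_const|]. now apply disc_limit_kern_sum.
    - intros z Hz. assert (H := HW z Hz). unfold Re in *; simpl in *; lra. }
  assert (H1W : forall z, Cmod z <= 1 -> 1 + Re (W z) <= Cmod (1 + W z)%C).
  { intros z Hz. eapply Rle_trans; [|apply Re_le_Cmod]. unfold Re; simpl; lra. }
  assert (HPW : forall z, Cmod z <= 1 -> Cmod (Phi z) <= Cmod (W z)).
  { intros z Hz. assert (H := H1W z Hz). assert (H0 := HW z Hz).
    assert (H2 : (1 + W z)%C <> RtoC 0) by (apply Cmod_gt_0; lra).
    unfold Phi. replace (1 - / (1 + W z))%C with (W z / (1 + W z))%C by (field; exact H2).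
    rewrite Cmod_div by exact H2. apply Rle_div_l; [lra|].
    assert (H3 := Cmod_ge_0 (W z)). nra. }
  destruct (HPhi (eps / 2) ltac:(lra)) as [phi Hphi]. exists phi.
  split; [|split; [|split]].
  - intros z Hz.
    replace (poly_eval phi z - / 2)%C
      with ((Phi z - / 2) + (poly_eval phi z - Phi z))%C by ring.
    eapply Rle_trans; [apply Cmod_triangle|].
    assert (H1 := Cmod_mobius_half (W z) (HW z Hz)). assert (H2 := Hphi z Hz).
    unfold Phi at 1. lra.
  - intros z Hz. assert (Hz1 := HA z Hz).
    replace (poly_eval phi z - 1)%C
      with ((Phi z - 1) + (poly_eval phi z - Phi z))%C by ring.
    eapply Rle_trans; [apply Cmod_triangle|]. assert (H2 := Hphi z Hz1).
    destruct (HcL0 z Hz) as [c [Hin Hzc]].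
    assert (Hq := Re_kern_sum_near d Hd L z c HL Hz1
      (proj2 (HL' c) (conj Hin (ex_intro _ z (conj Hz Hzc)))) Hzc).
    assert (H := H1W z Hz1). rewrite HReW in H.
    assert (Hne : (1 + W z)%C <> RtoC 0) by (apply Cmod_gt_0; nra).
    replace (Phi z - 1)%C with (- / (1 + W z))%C by (unfold Phi; ring).
    rewrite Cmod_opp, Cmod_inv by exact Hne.
    enough (/ Cmod (1 + W z) <= eps / 2) by lra.
    replace (eps / 2) with (/ (2 / eps)) by (field; lra).
    apply Rinv_le_contravar; [apply Rdiv_lt_0_compat; lra|].
    replace (2 / eps) with (N / 4) by (unfold N; field; lra). nra.
  - intros z Hz. assert (Hz1 := HF z Hz).
    replace (poly_eval phi z) with (Phi z + (poly_eval phi z - Phi z))%C by ring.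
    eapply Rle_trans; [apply Cmod_triangle|]. assert (H2 := Hphi z Hz1).
    enough (Cmod (W z) <= eps / 2) by (assert (H3 := HPW z Hz1); lra).
    rewrite HmW.
    assert (Hk : Cmod (kern_sum L d z) <= INR (length L) * (d / (r / 2))).
    { apply Cmod_kern_sum_le. intros c Hin. assert (Hdc := Hdr c Hin).
      (* With d <= r / 4 one has |z - c| >= r - d >= d + r / 2. *)
      apply Cmod_kern_far; auto; [lra|].
      destruct (proj2 (proj1 (HL' c) Hin)) as [a [Ha Hac]].
      assert (Hs := Hsep a z Ha Hz).
      replace (z - a)%C with ((z - c) - (a - c))%C in Hs by ring.
      assert (Ht := Cmod_triangle (z - c) (- (a - c))).
      rewrite Cmod_opp in Ht. unfold Cminus at 1 in Hs. lra. }
    replace (INR (length L) * (d / (r / 2))) with (INR (length L) * d / (r / 2)) in Hk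
      by (field; lra).
    assert (INR (length L) * d / (r / 2) <= eps / 2 / N).
    { apply Rle_div_l; lra. }
    replace (eps / 2) with (N * (eps / 2 / N)) by (field; lra).
    apply Rmult_le_compat_l; lra.
  - assert (Hz1 : Cmod (RtoC 0) <= 1) by (rewrite Cmod_0; lra).
    replace (poly_eval phi (RtoC 0))
      with (Phi (RtoC 0) + (poly_eval phi (RtoC 0) - Phi (RtoC 0)))%C by ring.
    eapply Rle_trans; [apply Cmod_triangle|]. assert (H2 := Hphi _ Hz1).
    enough (Cmod (W (RtoC 0)) <= eps / 2) by (assert (H3 := HPW _ Hz1); lra).
    rewrite HmW.
    assert (Hk : Cmod (kern_sum L d (RtoC 0)) <= INR (length L) * d).
    { apply Cmod_kern_sum_le. intros c Hin. now apply Cmod_kern_0. }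
    replace (eps / 2) with (N * (eps / 2 / N)) by (field; lra).
    apply Rmult_le_compat_l; lra.
Qed.

(** * Zero-free modification of a polynomial on a null set *)

Lemma circle_cis z : Cmod z = 1 -> exists t, 0 <= t < 2 * PI /\ z = cis t.
Proof.
  intros H. destruct z as [x y].
  assert (Hxy : x ^ 2 + y ^ 2 = 1).
  { change (x ^ 2 + y ^ 2) with (fst (x, y) ^ 2 + snd (x, y) ^ 2).
    rewrite <- Cmod_sq, H. ring. }
  assert (Hx : -1 <= x <= 1) by nra.
  assert (HP := acos_bound x). assert (HP0 := PI_RGT_0).
  assert (Hs : sin (acos x) = Rabs y).
  { rewrite sin_acos by exact Hx. rewrite <- sqrt_Rsqr_abs. f_equal. unfold Rsqr. lra. }
  destruct (Rle_dec 0 y) as [Hy|Hy].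
  - exists (acos x). split; [lra|]. unfold cis.
    rewrite cos_acos, Hs, Rabs_pos_eq by assumption. reflexivity.
  - exists (2 * PI - acos x). assert (acos x <> 0).
    { intros E. rewrite E, sin_0 in Hs. unfold Rabs in Hs. destruct (Rcase_abs y); lra. }
    split; [lra|]. unfold cis.
    replace (2 * PI - acos x) with (- acos x + 2 * INR 1 * PI) by (simpl; ring).
    rewrite cos_period, sin_period, cos_neg, sin_neg, cos_acos, Hs by assumption.
    rewrite Rabs_left by lra. f_equal; ring.
Qed.

(** The argument is taken in [0, 2 PI), so a quarter of it stays below PI / 2, where the cosine is
    positive. *)
Lemma fourth_root w : w <> RtoC 0 -> exists s, (s ^ 4)%C = w /\ 0 < Re s.
Proof.
  intros Hw. assert (Hm := proj1 (Cmod_gt_0 w) Hw).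
  assert (HmC : RtoC (Cmod w) <> RtoC 0) by (apply Cmod_pos_of_Re; exact Hm).
  destruct (circle_cis (w / RtoC (Cmod w))%C) as [t [Ht E]].
  { rewrite Cmod_div, Cmod_R, Rabs_pos_eq by (auto; lra). field; lra. }
  set (q := sqrt (sqrt (Cmod w))).
  assert (Hs := sqrt_lt_R0 _ Hm). assert (Hq : 0 < q) by now apply sqrt_lt_R0.
  assert (Hq4 : q ^ 4 = Cmod w).
  { replace (q ^ 4) with ((q ^ 2) ^ 2) by ring. unfold q.
    rewrite (pow2_sqrt (sqrt (Cmod w))) by lra. apply pow2_sqrt; lra. }
  exists (RtoC q * cis (t / 4))%C. split.
  - rewrite Cpow_mult_l, cis_pow, <- RtoC_pow, Hq4.
    replace (INR 4 * (t / 4)) with t by (simpl; field).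
    rewrite <- E. field. exact HmC.
  - assert (Hc : 0 < cos (t / 4)) by (apply cos_gt_0; lra).
    unfold Re, cis; simpl. nra.
Qed.

Lemma Cmod_pow4_minus x y X :
  Cmod x <= X -> Cmod y <= X -> Cmod (x ^ 4 - y ^ 4)%C <= 4 * X ^ 3 * Cmod (x - y)%C.
Proof.
  intros Hx Hy.
  replace (x ^ 4 - y ^ 4)%C with ((x - y) * ((x + y) * (x * x + y * y)))%C by ring.
  rewrite !Cmod_mult, Rmult_comm. apply Rmult_le_compat_r; [apply Cmod_ge_0|].
  assert (H1 := Cmod_triangle x y). assert (H2 := Cmod_triangle (x * x) (y * y)).
  rewrite !Cmod_mult in H2.
  assert (Hx0 := Cmod_ge_0 x). assert (Hy0 := Cmod_ge_0 y).
  replace (4 * X ^ 3) with ((2 * X) * (2 * (X * X))) by ring.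
  apply Rmult_le_compat; try apply Cmod_ge_0; nra.
Qed.

(* The values of 1 + (s - 1) phi stay, up to (|s - 1| eps), in the disc with diameter [1, s],
   which avoids 0 as soon as Re s > 0. *)
Lemma modify_poly (A F : C -> Prop) (r eta : R) (w : C) (P : list C) :
  small_covers A -> (forall z, A z -> Cmod z <= 1) -> (forall z, F z -> Cmod z <= 1) ->
  0 < r -> (forall a z, A a -> F z -> r <= Cmod (z - a)%C) -> 0 < eta ->
  w <> RtoC 0 -> (forall z, Cmod z <= 1 -> poly_eval P z <> RtoC 0) ->
  exists Q,
    (forall z, Cmod z <= 1 -> poly_eval Q z <> RtoC 0) /\
    (forall z, A z -> Cmod (poly_eval Q z - w * poly_eval P z)%C <= eta) /\
    (forall z, F z -> Cmod (poly_eval Q z - poly_eval P z)%C <= eta) /\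
    psq (psub Q P) <= eta.
Proof.
  intros Hcov HA HF Hr Hsep Heta Hw HP.
  destruct (fourth_root w Hw) as [s [Hs Hre]].
  destruct (poly_bound P) as [M [HM HPM]].
  set (sg := Cmod (s - 1)%C). assert (Hsg : 0 <= sg) by apply Cmod_ge_0.
  (* [X] bounds both |s| and |1 + (s - 1) phi|, and [K] is the resulting constant in |Q - P| <= K
     |phi|. *)
  set (X := 1 + 2 * sg). set (K := 4 * X ^ 3 * sg * M).
  assert (HX : 1 <= X) by (unfold X; lra).
  assert (HK : 0 <= K).
  { unfold K. repeat apply Rmult_le_pos; try lra. }
  (* The distance from 0 to the disc with diameter [1, s]; it is positive because |1 + s|^2 - |s -
     1|^2 = 4 Re s. *)
  set (c0 := (Cmod (1 + s)%C - sg) / 2).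
  assert (Hc0 : 0 < c0).
  { unfold c0. enough (sg < Cmod (1 + s)%C) by lra.
    assert (H1 := Cmod_sq (1 + s)%C). assert (H2 := Cmod_sq (s - 1)%C). fold sg in H2.
    assert (H3 := Cmod_ge_0 (1 + s)%C). unfold Re in Hre. simpl in H1, H2. nra. }
  (* The four bounds give in turn |phi| <= 2, the absence of zeros, the uniform errors K e <= eta,
     and 3 K^2 e <= eta for the norm. *)
  set (e := Rmin (Rmin (1 / 2) (c0 / 2 / (sg + 1)))
                 (Rmin (eta / (K + 1)) (eta / (3 * K ^ 2 + 1)))).
  assert (HK2 : 0 <= K ^ 2) by nra.
  assert (He : 0 < e).
  { unfold e. repeat apply Rmin_glb_lt; try lra; apply Rdiv_lt_0_compat; lra. }
  assert (He1 : e <= 1 / 2) by (eapply Rle_trans; [apply Rmin_l|apply Rmin_l]).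
  assert (He2 : e <= c0 / 2 / (sg + 1)) by (eapply Rle_trans; [apply Rmin_l|apply Rmin_r]).
  assert (He3 : e <= eta / (K + 1)) by (eapply Rle_trans; [apply Rmin_r|apply Rmin_l]).
  assert (He4 : e <= eta / (3 * K ^ 2 + 1))
    by (eapply Rle_trans; [apply Rmin_r|apply Rmin_r]).
  apply Rle_div_r in He2; [|lra]. apply Rle_div_r in He3; [|lra].
  apply Rle_div_r in He4; [|lra].
  destruct (peak_poly A F r e Hcov HA HF Hr Hsep He) as [phi [H1 [H2 [H3 H4]]]].
  set (L := padd (RtoC 1 :: nil) (pscal (s - 1)%C phi)).
  assert (HL : forall z, poly_eval L z = (1 + (s - 1) * poly_eval phi z)%C).
  { intros z. unfold L. rewrite eval_add, eval_scal. unfold poly_eval at 1; simpl. ring. }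
  set (Q := pmul P (pmul (pmul L L) (pmul L L))).
  assert (HQ : forall z, poly_eval Q z = (poly_eval P z * poly_eval L z ^ 4)%C).
  { intros z. unfold Q. rewrite !eval_mul. ring. }
  assert (Hphi1 : forall z, Cmod z <= 1 -> Cmod (poly_eval phi z) <= 2).
  { intros z Hz. assert (H := Cmod_le_minus _ _ _ (H1 z Hz)).
    rewrite Cmod_inv, Cmod_R, Rabs_pos_eq in H; try lra.
    apply Cmod_pos_of_Re; unfold Re; simpl; lra. }
  assert (HLX : forall z, Cmod z <= 1 -> Cmod (poly_eval L z) <= X).
  { intros z Hz. rewrite HL. eapply Rle_trans; [apply Cmod_triangle|].
    rewrite Cmod_1, Cmod_mult. fold sg. assert (H := Hphi1 z Hz).
    unfold X. nra. }
  assert (HsX : Cmod s <= X).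
  { assert (H := Cmod_le_minus s 1 sg (Rle_refl _)). rewrite Cmod_1 in H. unfold X; lra. }
  assert (H4P : forall z y b, Cmod z <= 1 -> Cmod y <= X ->
     Cmod (poly_eval L z - y)%C <= sg * b -> 0 <= b ->
     Cmod (poly_eval P z * (poly_eval L z ^ 4 - y ^ 4))%C <= K * b).
  { intros z y b Hz Hy Hb Hb0. rewrite Cmod_mult.
    assert (Hp4 := Cmod_pow4_minus _ _ _ (HLX z Hz) Hy).
    assert (HX3 : 0 <= 4 * X ^ 3) by (apply Rmult_le_pos; [lra|apply pow_le; lra]).
    replace (K * b) with (M * (4 * X ^ 3 * (sg * b))) by (unfold K; ring).
    apply Rmult_le_compat; auto using Cmod_ge_0.
    eapply Rle_trans; [exact Hp4|]. now apply Rmult_le_compat_l. }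
  assert (HQP : forall z, Cmod z <= 1 ->
     Cmod (poly_eval Q z - poly_eval P z)%C <= K * Cmod (poly_eval phi z)).
  { intros z Hz. rewrite HQ.
    replace (poly_eval P z * poly_eval L z ^ 4 - poly_eval P z)%C
      with (poly_eval P z * (poly_eval L z ^ 4 - 1 ^ 4))%C by ring.
    apply H4P; auto using Cmod_ge_0; [rewrite Cmod_1; lra|].
    unfold sg; rewrite HL, <- Cmod_mult. apply Req_le. f_equal. ring. }
  exists Q. split; [|split; [|split]].
  - intros z Hz. rewrite HQ. apply Cmult_neq_0; [now apply HP|]. apply Cpow_nz.
    apply Cmod_gt_0. rewrite HL.
    replace (1 + (s - 1) * poly_eval phi z)%C
      with ((1 + s) / 2 - (s - 1) * (- (poly_eval phi z - / 2)))%C by field.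
    eapply Rlt_le_trans; [|apply Cmod_minus_ge].
    rewrite Cmod_mult, Cmod_opp. fold sg.
    rewrite Cmod_div, (Cmod_R 2), Rabs_pos_eq;
      try (apply Cmod_pos_of_Re; unfold Re; simpl); try lra.
    assert (H := H1 z Hz). assert (Hc := eq_refl c0). unfold c0 at 2 in Hc. nra.
  - intros z Hz. rewrite HQ.
    replace (poly_eval P z * poly_eval L z ^ 4 - w * poly_eval P z)%C
      with (poly_eval P z * (poly_eval L z ^ 4 - s ^ 4))%C by (rewrite Hs; ring).
    apply Rle_trans with (K * e); [|nra].
    apply H4P; auto; [|lra]. rewrite HL.
    replace (1 + (s - 1) * poly_eval phi z - s)%C
      with ((s - 1) * (poly_eval phi z - 1))%C by ring.
    rewrite Cmod_mult. apply Rmult_le_compat_l; [exact Hsg|]. now apply H2.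
  - intros z Hz. eapply Rle_trans; [now apply HQP, HF|].
    assert (H := H3 z Hz). nra.
  (* From |phi - 1/2| <= 1/2 + e follows |phi|^2 <= Re phi + e + e^2 <= Re phi + 2 e; the average is
     at most 3 e because Re phi(0) <= e. *)
  - assert (H := psq_le (psub Q P) nil nil (pscal (RtoC (K ^ 2)) phi) 0 0 (K ^ 2 * (2 * e))).
    rewrite !Rmult_0_l, !Rplus_0_l in H.
    eapply Rle_trans; [apply H; clear H|].
    + intros z Hz. rewrite !Rmult_0_l, !Rplus_0_l, eval_sub, eval_scal.
      assert (Hd := HQP z ltac:(lra)). assert (Hd0 := Cmod_ge_0 (poly_eval Q z - poly_eval P z)%C).
      assert (Hd2 : Cmod (poly_eval Q z - poly_eval P z)%C ^ 2
                    <= (K * Cmod (poly_eval phi z)) ^ 2) by (apply pow_incr; lra).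
      eapply Rle_trans; [exact Hd2|]. rewrite Rpow_mult_distr.
      replace (Re (RtoC (K ^ 2) * poly_eval phi z)%C)
        with (K ^ 2 * Re (poly_eval phi z)) by (unfold Re; simpl; ring).
      rewrite <- Rmult_plus_distr_l. apply Rmult_le_compat_l; [exact HK2|].
      assert (Hh := H1 z ltac:(lra)).
      assert (Hh2 : Cmod (poly_eval phi z - / 2)%C ^ 2 <= (/ 2 + e) ^ 2)
        by (apply pow_incr; split; [apply Cmod_ge_0|exact Hh]).
      rewrite <- RtoC_inv in Hh2 by lra.
      rewrite Cmod_sq in Hh2 |- *. unfold Re. simpl in Hh2 |- *. nra.
    + rewrite eval_scal.
      replace (Re (RtoC (K ^ 2) * poly_eval phi (RtoC 0))%C)
        with (K ^ 2 * Re (poly_eval phi (RtoC 0))) by (unfold Re; simpl; ring).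
      assert (Hh := Re_le_Cmod (poly_eval phi (RtoC 0))). nra.
Qed.

(** * Closed subsets of the circle *)

Lemma Rabs_sin_le x : Rabs (sin x) <= Rabs x.
Proof.
  assert (H : forall y, 0 <= y -> Rabs (sin y) <= y).
  { intros y [Hy|<-]; [|rewrite sin_0, Rabs_R0; lra].
    assert (H1 := sin_lt_x y Hy). apply Rabs_le. split; [|lra].
    destruct (Rle_dec y 1).
    - assert (0 < sin y) by (apply sin_gt_0; [|generalize PI2_1]; lra). lra.
    - assert (H2 := SIN_bound y). lra. }
  destruct (Rle_dec 0 x) as [Hx|Hx].
  - rewrite (Rabs_pos_eq x) by exact Hx. now apply H.
  - rewrite <- (Rabs_Ropp x), <- Rabs_Ropp, <- sin_neg, (Rabs_pos_eq (- x)) by lra.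
    apply H; lra.
Qed.

(** The chord has length 2 |sin u|, where u is half the difference of the arguments. *)
Lemma cis_lipschitz s t : Cmod (cis s - cis t)%C <= Rabs (s - t).
Proof.
  apply Cmod_le_sq; [apply Rabs_pos|].
  rewrite pow2_abs.
  set (u := (s - t) / 2). set (v := (s + t) / 2).
  replace (s - t) with (2 * u) by (unfold u; field).
  simpl. replace s with (v + u) by (unfold u, v; field).
  replace t with (v - u) by (unfold u, v; field).
  rewrite cos_plus, cos_minus, sin_plus, sin_minus.
  assert (H := sin2_cos2 v). assert (H1 := Rabs_sin_le u).
  apply Rsqr_le_abs_1 in H1. unfold Rsqr in *. nra.
Qed.

(** Basic neighbourhoods in [C] are squares; halving the radius absorbs the factor sqrt 2. *)
Lemma locally_Cmod (z : C) (e : R) : 0 < e -> locally z (fun y => Cmod (y - z)%C < e).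
Proof.
  intros He. assert (He2 : 0 < e / 2) by lra. exists (mkposreal _ He2). intros y Hy.
  apply C_NormedModule_mixin_compat2 in Hy. simpl in Hy.
  eapply Rlt_le_trans; [exact Hy|].
  assert (Hs : sqrt 2 <= 2) by (rewrite <- (sqrt_Rsqr 2) at 2 by lra;
    apply sqrt_le_1_alt; unfold Rsqr; lra). nra.
Qed.

Lemma closed_compl (E : C -> Prop) z :
  closed E -> ~ E z -> exists e, 0 < e /\ forall y, Cmod (y - z)%C < e -> ~ E y.
Proof.
  intros HE Hz.
  assert (H : locally z (fun y => ~ E y)) by (apply NNPP; intros H; now apply Hz, HE).
  destruct H as [e He]. exists e. split; [apply cond_pos|].
  intros y Hy. apply He. apply C_NormedModule_mixin_compat1. exact Hy.
Qed.

(** * Compactness arguments on a closed subset of the circle *)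

Section ClosedCircleSet.

Variable E : C -> Prop.
Hypotheses (HEcirc : forall z, E z -> Cmod z = 1) (HEclosed : closed E).

(** An argument outside [E] gets a radius within which no argument of [E] lies. Hence the centers
    that compactness of [0, 2 PI] supplies near [E] belong to [E] themselves. *)
Lemma lebesgue_number_arg (gam : R -> R) :
  (forall t, 0 <= t <= 2 * PI -> E (cis t) -> 0 < gam t) ->
  exists d, 0 < d /\ forall s, 0 <= s <= 2 * PI -> E (cis s) ->
    exists t, E (cis t) /\ 0 <= t <= 2 * PI /\ Rabs (s - t) < gam t /\ d <= gam t.
Proof.
  intros Hg.
  assert (Hdel : forall t, exists d : posreal, 0 <= t <= 2 * PI ->
     (E (cis t) -> pos d = gam t) /\
     (~ E (cis t) -> forall s, Rabs (s - t) < d -> ~ E (cis s))).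
  { intros t. destruct (classic (0 <= t <= 2 * PI)) as [Ht|Ht].
    2: { exists (mkposreal 1 Rlt_0_1). tauto. }
    destruct (classic (E (cis t))) as [HEt|HEt].
    - exists (mkposreal _ (Hg t Ht HEt)). intuition.
    - destruct (closed_compl E _ HEclosed HEt) as [e [He H]].
      exists (mkposreal e He). intros _. split; [tauto|]. intros _ s Hs. apply H.
      eapply Rle_lt_trans; [apply cis_lipschitz|exact Hs]. }
  apply ClassicalEpsilon.choice in Hdel. destruct Hdel as [del Hdel].
  destruct (compactness_value_1d 0 (2 * PI) del) as [d Hd].
  exists d. split; [apply cond_pos|]. intros s Hs HEs.
  destruct (NNPP _ (Hd s Hs)) as [t [Ht [Hst Hdt]]].
  destruct (Hdel t Ht) as [H1 H2]. exists t.
  destruct (classic (E (cis t))) as [HEt|HEt].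
  - rewrite (H1 HEt) in *. auto.
  - now destruct (H2 HEt s Hst).
Qed.

Lemma lebesgue_number (gam : C -> R) :
  (forall z, E z -> 0 < gam z) ->
  exists d, 0 < d /\ forall z, E z ->
    exists y, E y /\ Cmod (z - y)%C < gam y /\ d <= gam y.
Proof.
  intros Hg.
  destruct (lebesgue_number_arg (fun t => gam (cis t))) as [d [Hd H]]; [auto|].
  exists d. split; [exact Hd|]. intros z Hz.
  destruct (circle_cis z (HEcirc z Hz)) as [s [Hs ->]].
  destruct (H s ltac:(lra) Hz) as [t [HEt [Ht [Hst Hdt]]]].
  exists (cis t). split; [exact HEt|]. split; [|exact Hdt].
  eapply Rle_lt_trans; [apply cis_lipschitz|exact Hst].
Qed.

Definition continuous_within (f : C -> C) (z : C) : Prop :=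
  forall eta, 0 < eta -> exists d, 0 < d /\
    forall y, E y -> Cmod (y - z)%C < d -> Cmod (f y - f z)%C < eta.

(** The Lebesgue number d is a lower bound for the gauge at the chosen centers; building 1 / (|f| +
    1) into the gauge turns it into the upper bound 1 / d. *)
Lemma bounded_on_closed (f : C -> C) :
  (forall z, E z -> continuous_within f z) ->
  exists B, 0 < B /\ forall z, E z -> Cmod (f z) <= B.
Proof.
  intros Hf.
  assert (Hg : forall z, exists g, E z -> 0 < g /\ g <= / (Cmod (f z) + 1) /\
     forall y, E y -> Cmod (y - z)%C < g -> Cmod (f y - f z)%C < 1).
  { intros z. destruct (classic (E z)) as [Hz|Hz]; [|exists 0; tauto].
    destruct (Hf z Hz 1 Rlt_0_1) as [d [Hd H]].
    assert (H0 := Cmod_ge_0 (f z)).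
    exists (Rmin d (/ (Cmod (f z) + 1))). intros _. split; [|split; [apply Rmin_r|]].
    - apply Rmin_glb_lt; [exact Hd|]. apply Rinv_0_lt_compat; lra.
    - intros y Hy Hyz. apply H; [exact Hy|]. eapply Rlt_le_trans; [exact Hyz|apply Rmin_l]. }
  apply ClassicalEpsilon.choice in Hg. destruct Hg as [g Hg].
  destruct (lebesgue_number g) as [d [Hd H]]; [intros z Hz; apply Hg, Hz|].
  exists (/ d). split; [now apply Rinv_0_lt_compat|]. intros z Hz.
  destruct (H z Hz) as [y [Hy [Hzy Hdy]]]. destruct (Hg y Hy) as [H1 [H2 H3]].
  assert (H4 := H3 z Hz Hzy). apply Rlt_le, Cmod_le_minus in H4.
  assert (H0 := Cmod_ge_0 (f y)).
  eapply Rle_trans; [exact H4|]. rewrite <- (Rinv_inv (Cmod (f y) + 1)).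
  apply Rinv_le_contravar; lra.
Qed.

Lemma uniformly_continuous_on_closed (f : C -> C) (eta : R) :
  (forall z, E z -> continuous_within f z) -> 0 < eta ->
  exists d, 0 < d /\ forall z y, E z -> E y ->
    Cmod (z - y)%C < d -> Cmod (f z - f y)%C <= eta.
Proof.
  intros Hf Heta.
  assert (Hg : forall z, exists g, E z -> 0 < g /\
     forall y, E y -> Cmod (y - z)%C < 2 * g -> Cmod (f y - f z)%C < eta / 2).
  { intros z. destruct (classic (E z)) as [Hz|Hz]; [|exists 0; tauto].
    destruct (Hf z Hz (eta / 2) ltac:(lra)) as [d [Hd H]].
    exists (d / 2). intros _. split; [lra|]. intros y Hy Hyz. apply H; [exact Hy|lra]. }
  apply ClassicalEpsilon.choice in Hg. destruct Hg as [g Hg].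
  destruct (lebesgue_number g) as [d [Hd H]]; [intros z Hz; apply Hg, Hz|].
  exists d. split; [exact Hd|]. intros z y Hz Hy Hzy.
  destruct (H z Hz) as [x [Hx [Hzx Hdx]]]. destruct (Hg x Hx) as [H1 H2].
  assert (H3 := H2 z Hz ltac:(lra)).
  assert (Hyx : Cmod (y - x)%C < 2 * g x).
  { replace (y - x)%C with ((z - x) + (y - z))%C by ring.
    eapply Rle_lt_trans; [apply Cmod_triangle|].
    rewrite (Cmod_minus_sym y z). lra. }
  assert (H4 := H2 y Hy Hyx).
  replace (f z - f y)%C with ((f z - f x) - (f y - f x))%C by ring.
  unfold Cminus at 1. eapply Rle_trans; [apply Cmod_triangle|]. rewrite Cmod_opp. lra.
Qed.

(* An open U containing the arguments of E, of length < eps/2, contains all sufficiently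
   short grid cells that meet the (compact) set of arguments. *)
Lemma null_small_covers : null_on_circle E -> small_covers E.
Proof.
  intros Hnull eps Heps.
  destruct (Measure.negligible_open_R _ (2 * PI) (eps / 2) Hnull ltac:(lra))
    as [U [HUo [HTU HU]]].
  assert (Hg : forall t, exists g, 0 <= t <= 2 * PI -> E (cis t) -> 0 < g /\
     forall s, Rabs (s - t) < 2 * g -> U s).
  { intros t. destruct (classic (0 <= t <= 2 * PI /\ E (cis t))) as [[Ht HE]|Ht].
    2: { exists 0; tauto. }
    destruct (HUo t) as [e [He H]].
    - apply HTU. destruct (Rle_lt_or_eq_dec _ _ (proj2 Ht)) as [Hlt|Heq]; [left|now right].
      split; [lra|exact HE].
    - exists (e / 2). intros _ _. split; [lra|]. intros s Hs. apply H. lra. }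
  apply ClassicalEpsilon.choice in Hg. destruct Hg as [g Hg].
  destruct (lebesgue_number_arg g) as [d [Hd HL]]; [intros t Ht HE; now apply Hg|].
  assert (HP := PI_RGT_0).
  destruct (nfloor_ex (2 * PI / d)) as [m [_ Hm]].
  { apply Rdiv_le_0_compat; lra. }
  set (n := S m). assert (Hn : 0 < INR n) by (apply lt_0_INR; unfold n; lia).
  set (h := 2 * PI / INR n).
  assert (Hh : 0 < h) by (apply Rdiv_lt_0_compat; lra).
  assert (Hhn : INR n * h = 2 * PI) by (unfold h; field; lra).
  assert (Hhd : h < d).
  { unfold h. apply Rlt_div_l; [exact Hn|]. rewrite <- S_INR in Hm. fold n in Hm.
    apply Rlt_div_l in Hm; lra. }
  assert (Hb : exists b : nat -> bool, forall i, b i = true <->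
     exists t, (0 <= t <= 2 * PI /\ E (cis t)) /\ INR i * h <= t < INR (S i) * h).
  { apply (ClassicalEpsilon.choice (fun i c => c = true <-> exists t,
      (0 <= t <= 2 * PI /\ E (cis t)) /\ INR i * h <= t < INR (S i) * h)).
    intros i. destruct (classic (exists t,
      (0 <= t <= 2 * PI /\ E (cis t)) /\ INR i * h <= t < INR (S i) * h)) as [H|H].
    - exists true. tauto.
    - exists false. split; [discriminate|tauto]. }
  destruct Hb as [b Hb].
  exists (map (fun i => cis (INR i * h)) (filter b (seq 0 n))), h.
  split; [exact Hh|]. split; [|split].
  - rewrite length_map. enough (INR (length (filter b (seq 0 n))) * h <= eps / 2) by lra.
    apply HU; [lra|]. intros i Hi Hbi s Hs.
    (* Points of this cell are within h < d <= g u of t, and t is within g u of u; hence the factor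
       2 in the choice of [g]. *)
    destruct (proj1 (Hb i) Hbi) as [t [[Ht HE] Hti]].
    destruct (HL t Ht HE) as [u [HEu [Hu [Htu Hdu]]]].
    apply (proj2 (Hg u Hu HEu)). rewrite S_INR in *.
    unfold Rabs in *; repeat destruct Rcase_abs; lra.
  - intros c Hc. apply in_map_iff in Hc. destruct Hc as [i [<- _]]. apply cis_mod.
  - intros z Hz. destruct (circle_cis z (HEcirc z Hz)) as [t [Ht ->]].
    destruct (nfloor_ex (t / h)) as [i Hi]; [apply Rdiv_le_0_compat; lra|].
    assert (Hti : INR i * h <= t < INR (S i) * h).
    { rewrite S_INR. split; [apply Rle_div_r|apply Rlt_div_l]; lra. }
    exists (cis (INR i * h)). split.
    + apply in_map_iff. exists i. split; [reflexivity|]. apply filter_In. split.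
      * apply in_seq. split; [lia|]. simpl. apply INR_lt. nra.
      * apply Hb. exists t. split; [|exact Hti]. split; [lra|exact Hz].
    + eapply Rle_trans; [apply cis_lipschitz|]. rewrite S_INR in Hti.
      rewrite Rabs_pos_eq; lra.
Qed.

(* The pieces are the connected components of the graph joining two centers at distance
   less than 3d: a component has diameter at most 3d times the number of centers. *)
Lemma small_pieces (rho : R) :
  small_covers E -> 0 < rho ->
  exists (lab : C -> nat) (n : nat) (d : R), 0 < d /\
    (forall z, E z -> (lab z < n)%nat) /\
    forall z y, E z -> E y ->
      (lab z <> lab y -> d <= Cmod (z - y)%C) /\
      (lab z = lab y -> Cmod (z - y)%C <= rho).
Proof.
  intros Hcov Hrho.
  (* Centers 3 d apart leave d between the points themselves, and a piece has diameter at most 3 n d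
     + 2 d <= 5 n d. *)
  destruct (Hcov (rho / 5) ltac:(lra)) as [L [d [Hd [HLd [HL1 HL]]]]].
  set (c := fun i => nth i L (RtoC 0)). set (n := length L) in *.
  destruct (Measure.components_label n (fun i j => Cmod (c i - c j)%C) (3 * d))
    as [lab [Hlab1 Hlab2]].
  - intros i. replace (c i - c i)%C with (RtoC 0) by ring. apply Cmod_0.
  - intros; apply Cmod_minus_sym.
  - intros i j k. replace (c i - c k)%C with ((c i - c j) + (c j - c k))%C by ring.
    apply Cmod_triangle.
  - lra.
  - assert (Hi : forall z, exists i, E z -> (i < n)%nat /\ Cmod (z - c i)%C <= d).
    { intros z. destruct (classic (E z)) as [Hz|Hz]; [|exists O; tauto].
      destruct (HL z Hz) as [x [Hx Hzx]]. destruct (In_nth L x (RtoC 0) Hx) as [i [Hi Hxi]].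
      exists i. intros _. split; [exact Hi|]. unfold c. now rewrite Hxi. }
    apply ClassicalEpsilon.choice in Hi. destruct Hi as [ix Hix].
    exists (fun z => lab (ix z)), n, d. split; [exact Hd|]. split.
    { intros z Hz. now apply Hlab1, Hix. }
    intros z y Hz Hy. destruct (Hix z Hz) as [Hz1 Hz2]. destruct (Hix y Hy) as [Hy1 Hy2].
    destruct (Hlab2 _ _ Hz1 Hy1) as [H1 H2]. rewrite Cmod_minus_sym in Hy2. split.
    + intros Hne. specialize (H1 Hne).
      replace (c (ix z) - c (ix y))%C
        with (- (z - c (ix z)) + (z - y) + - (c (ix y) - y))%C in H1 by ring.
      assert (H3 := Cmod_triangle (- (z - c (ix z)) + (z - y)) (- (c (ix y) - y))).
      assert (H4 := Cmod_triangle (- (z - c (ix z))) (z - y)).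
      rewrite !Cmod_opp in *. lra.
    + intros Heq. specialize (H2 Heq).
      replace (z - y)%C with ((z - c (ix z)) + (c (ix z) - c (ix y)) + (c (ix y) - y))%C by ring.
      eapply Rle_trans; [apply Cmod_triangle|].
      assert (H4 := Cmod_triangle (z - c (ix z)) (c (ix z) - c (ix y))).
      assert (H5 : 1 <= INR n) by (apply (le_INR 1); lia).
      nra.
Qed.

End ClosedCircleSet.

(** * Zero-free polynomials close to g *)

Lemma poly_lipschitz p : exists M, 0 < M /\
  forall z y, Cmod z <= 1 -> Cmod y <= 1 ->
    Cmod (poly_eval p z - poly_eval p y)%C <= M * Cmod (z - y)%C.
Proof.
  induction p as [|c p [M [HM H]]].
  - exists 1. split; [lra|]. intros z y _ _.
    replace (poly_eval nil z - poly_eval nil y)%C with (RtoC 0)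
      by (unfold poly_eval; simpl; ring).
    rewrite Cmod_0. assert (H := Cmod_ge_0 (z - y)%C). lra.
  - destruct (poly_bound p) as [B [HB Hp]]. exists (M + B). split; [lra|].
    intros z y Hz Hy. rewrite !eval_cons.
    replace (c + z * poly_eval p z - (c + y * poly_eval p y))%C
      with (z * (poly_eval p z - poly_eval p y) + (z - y) * poly_eval p y)%C by ring.
    eapply Rle_trans; [apply Cmod_triangle|]. rewrite !Cmod_mult.
    assert (H1 := H z y Hz Hy). assert (H2 := Hp y Hy).
    assert (H3 := Cmod_ge_0 (poly_eval p z - poly_eval p y)%C).
    assert (H4 := Cmod_ge_0 (z - y)%C). assert (H5 := Cmod_ge_0 z). nra.
Qed.

Lemma eval_app p c z : poly_eval (p ++ c :: nil) z = (poly_eval p z + c * z ^ length p)%C.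
Proof.
  induction p as [|a p IH].
  - unfold poly_eval; simpl; ring.
  - simpl app. rewrite !eval_cons, IH. simpl length. rewrite Cpow_S. ring.
Qed.

Lemma psq_app p c : psq (p ++ c :: nil) = psq p + Cmod c ^ 2.
Proof.
  induction p as [|a p IH]; [unfold psq; simpl; ring|].
  change (psq ((a :: p) ++ c :: nil)) with (Cmod a ^ 2 + psq (p ++ c :: nil)).
  change (psq (a :: p)) with (Cmod a ^ 2 + psq p). rewrite IH. ring.
Qed.

(** * Triangle inequalities for squared H^2 distances *)

Lemma cmod_sq_minus_le x y : Cmod (x - y)%C ^ 2 <= 2 * Cmod x ^ 2 + 2 * Cmod y ^ 2.
Proof.
  rewrite !Cmod_sq. simpl.
  assert (H := pow2_ge_0 (fst x + fst y)). assert (H1 := pow2_ge_0 (snd x + snd y)). nra.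
Qed.

(** [Series] is total, so estimates on [H2_dist2] carry information only together with
    convergence. *)
Lemma ex_series_H2_dist2 g q :
  ex_series (fun k => Cmod (g k) ^ 2) ->
  ex_series (fun k => Cmod (g k - poly_coef q k)%C ^ 2).
Proof.
  intros Hg.
  apply (ex_series_le (V := R_CompleteNormedModule) _
    (fun k => 2 * Cmod (g k) ^ 2 + 2 * Cmod (poly_coef q k) ^ 2)).
  - intros k. change (norm ?x) with (Rabs x). rewrite Rabs_pos_eq by apply pow2_ge_0.
    apply cmod_sq_minus_le.
  - apply (ex_series_plus (fun k => 2 * Cmod (g k) ^ 2)
      (fun k => 2 * Cmod (poly_coef q k) ^ 2)).
    + now apply (ex_series_scal_l 2 (fun k => Cmod (g k) ^ 2)).
    + apply (ex_series_scal_l 2 (fun k => Cmod (poly_coef q k) ^ 2)).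
      exists (psq q). apply is_series_psq.
Qed.

Lemma H2_dist2_ge_0 g q : ex_series (fun k => Cmod (g k) ^ 2) -> 0 <= H2_dist2 g q.
Proof.
  intros Hg. apply Rle_trans with (psq nil); [apply Rle_refl|].
  rewrite <- (is_series_unique _ _ (is_series_psq nil)).
  apply Series_le; [|now apply ex_series_H2_dist2].
  intros k. replace (poly_coef nil k) with (RtoC 0) by (destruct k; reflexivity).
  rewrite Cmod_0. split; [lra|]. rewrite pow_ne_zero by lia. apply pow2_ge_0.
Qed.

Lemma H2_dist2_psub g p q :
  ex_series (fun k => Cmod (g k) ^ 2) ->
  H2_dist2 g p <= 2 * H2_dist2 g q + 2 * psq (psub p q).
Proof.
  intros Hg. assert (Hq := ex_series_H2_dist2 g q Hg).
  unfold H2_dist2.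
  rewrite <- (is_series_unique _ _ (is_series_psq (psub p q))), <- !Series_scal_l.
  assert (H1 : ex_series (fun k => 2 * Cmod (g k - poly_coef q k)%C ^ 2))
    by now apply (ex_series_scal_l 2 (fun k => Cmod (g k - poly_coef q k)%C ^ 2)).
  assert (H2 : ex_series (fun k => 2 * Cmod (poly_coef (psub p q) k) ^ 2)).
  { apply (ex_series_scal_l 2 (fun k => Cmod (poly_coef (psub p q) k) ^ 2)).
    exists (psq (psub p q)). apply is_series_psq. }
  rewrite <- Series_plus by assumption.
  apply Series_le; [|now apply (ex_series_plus (V := R_NormedModule))].
  intros k. split; [apply pow2_ge_0|]. rewrite coef_sub.
  replace (g k - poly_coef p k)%C
    with ((g k - poly_coef q k) - (poly_coef p k - poly_coef q k))%C by ring.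
  apply cmod_sq_minus_le.
Qed.

Lemma pow_small (b rho e : R) : 0 <= b -> 0 <= rho < 1 -> 0 < e ->
  exists N, forall n, (N <= n)%nat -> b * rho ^ n <= e.
Proof.
  intros Hb Hr He.
  destruct (pow_lt_1_zero rho ltac:(rewrite Rabs_pos_eq; lra) (e / (b + 1))
    ltac:(apply Rdiv_lt_0_compat; lra)) as [N HN].
  exists N. intros n Hn. specialize (HN n Hn).
  rewrite Rabs_pos_eq in HN by (apply pow_le; lra).
  apply Rlt_div_r in HN; [|lra].
  assert (H : 0 <= rho ^ n) by (apply pow_le; lra). nra.
Qed.

Lemma one_minus_pow_le (r : R) k : 0 <= r <= 1 -> 0 <= 1 - r ^ k <= INR k * (1 - r).
Proof.
  intros Hr. induction k as [|k IH]; [simpl; lra|].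
  rewrite S_INR. simpl. assert (H : 0 <= r ^ k) by (apply pow_le; lra). nra.
Qed.

(** * Dilated Taylor polynomials of a zero-free H^2 function *)

Section Dilation.

Variable g : nat -> C.
Hypothesis Hg2 : ex_series (fun k => Cmod (g k) ^ 2).

Let S2 := Series (fun k => Cmod (g k) ^ 2).

(** A partial sum of g(r z); r = 1 gives the Taylor polynomials of g. *)
Definition dilate_trunc (r : R) (n : nat) : list C :=
  map (fun k => (g k * RtoC (r ^ k))%C) (seq 0 n).

Lemma dilate_trunc_S r n :
  dilate_trunc r (S n) = dilate_trunc r n ++ (g n * RtoC (r ^ n))%C :: nil.
Proof. unfold dilate_trunc. rewrite seq_S, map_app. reflexivity. Qed.

Lemma length_dilate_trunc r n : length (dilate_trunc r n) = n.
Proof. unfold dilate_trunc. now rewrite length_map, length_seq. Qed.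

Lemma eval_dilate_trunc r n z :
  poly_eval (dilate_trunc r n) z = csum (fun k => g k * (RtoC r * z) ^ k)%C n.
Proof.
  induction n as [|n IH]; [reflexivity|].
  rewrite dilate_trunc_S, eval_app, IH, length_dilate_trunc. simpl csum.
  rewrite Cpow_mult_l, <- RtoC_pow. ring.
Qed.

Lemma coef_dilate_trunc r n k :
  (k < n)%nat -> poly_coef (dilate_trunc r n) k = (g k * RtoC (r ^ k))%C.
Proof.
  intros Hk. unfold poly_coef.
  rewrite (nth_indep _ _ ((fun k => (g k * RtoC (r ^ k))%C) O))
    by now rewrite length_dilate_trunc.
  unfold dilate_trunc.
  rewrite (map_nth (fun k => (g k * RtoC (r ^ k))%C)), seq_nth by exact Hk. reflexivity.
Qed.

Lemma coef_dilate_trunc_high r n k :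
  (n <= k)%nat -> poly_coef (dilate_trunc r n) k = RtoC 0.
Proof. intros Hk. unfold poly_coef. apply nth_overflow. now rewrite length_dilate_trunc. Qed.

Lemma psq_dilate_trunc n :
  psq (dilate_trunc 1 (S n)) = sum_n (fun k => Cmod (g k) ^ 2) n.
Proof.
  induction n as [|n IH].
  - rewrite sum_O. unfold psq, dilate_trunc; simpl. rewrite Cmult_1_r. ring.
  - rewrite dilate_trunc_S, psq_app, IH, sum_Sn, pow1, Cmult_1_r. reflexivity.
Qed.

(** x^2 <= S2 implies x <= S2 + 1, a crude bound without square roots that suffices for geometric
    tails. *)
Lemma coef_bound k : Cmod (g k) <= S2 + 1.
Proof.
  assert (Hs : is_lim_seq (sum_n (fun k => Cmod (g k) ^ 2)) S2)
    by exact (Series_correct _ Hg2).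
  assert (Hinc : forall n, sum_n (fun k => Cmod (g k) ^ 2) n
                        <= sum_n (fun k => Cmod (g k) ^ 2) (S n)).
  { intros n. rewrite sum_Sn. assert (H := pow2_ge_0 (Cmod (g (S n)))).
    unfold plus; simpl in *; lra. }
  assert (H := is_lim_seq_incr_compare _ _ Hs Hinc k).
  assert (Hk : Cmod (g k) ^ 2 <= S2).
  { eapply Rle_trans; [|exact H]. destruct k as [|k]; [rewrite sum_O; lra|].
    rewrite sum_Sn. rewrite <- psq_dilate_trunc.
    assert (H0 := psq_ge_0 (dilate_trunc 1 (S k))). unfold plus; simpl in *; lra. }
  assert (H0 := Cmod_ge_0 (g k)). nra.
Qed.

(** The right side is the exact sum of B rho^k over n <= k < n + j, so the induction on [j] closes
    without loss. *)
Lemma csum_tail_bound (B rho : R) z n j :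
  (forall k, Cmod (g k) <= B) -> 0 <= rho < 1 -> Cmod z <= rho ->
  Cmod (csum (fun k => g k * z ^ k)%C (n + j) - csum (fun k => g k * z ^ k)%C n)%C
    <= B * rho ^ n * (1 - rho ^ j) / (1 - rho).
Proof.
  intros HB Hr Hz. induction j as [|j IH].
  - rewrite Nat.add_0_r.
    replace (csum (fun k => g k * z ^ k) n - csum (fun k => g k * z ^ k) n)%C
      with (RtoC 0) by ring.
    rewrite Cmod_0. apply Req_le. simpl. field. lra.
  - rewrite Nat.add_succ_r. simpl csum.
    replace (csum (fun k => g k * z ^ k) (n + j) + g (n + j)%nat * z ^ (n + j)
             - csum (fun k => g k * z ^ k) n)%C
      with ((csum (fun k => g k * z ^ k) (n + j) - csum (fun k => g k * z ^ k) n)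
            + g (n + j)%nat * z ^ (n + j))%C by ring.
    eapply Rle_trans; [apply Cmod_triangle|]. rewrite Cmod_mult, Cmod_pow.
    replace (B * rho ^ n * (1 - rho ^ S j) / (1 - rho))
      with (B * rho ^ n * (1 - rho ^ j) / (1 - rho) + B * rho ^ (n + j)).
    2: { rewrite pow_add. simpl. field. lra. }
    apply Rplus_le_compat; [exact IH|].
    apply Rmult_le_compat; auto using Cmod_ge_0.
    + apply pow_le, Cmod_ge_0.
    + apply pow_incr. split; [apply Cmod_ge_0|exact Hz].
Qed.

Lemma pseries_tail_bound (B rho : R) z l n :
  (forall k, Cmod (g k) <= B) -> 0 <= rho < 1 -> Cmod z <= rho ->
  is_pseries (K := C_AbsRing) (V := C_NormedModule) g z l ->
  Cmod (csum (fun k => g k * z ^ k)%C n - l)%C <= B * rho ^ n / (1 - rho).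
Proof.
  intros HB Hr Hz Hl.
  assert (HB0 : 0 <= B) by (eapply Rle_trans; [apply Cmod_ge_0|exact (HB O)]).
  apply le_epsilon. intros e He.
  destruct (Hl _ (locally_Cmod l e He)) as [m Hm].
  specialize (Hm (n + m)%nat ltac:(lia)).
  (* [sum_n] includes its last index while [csum] stops before its bound, hence the shift by one. *)
  assert (Hsum : forall N, sum_n (fun k => scal (pow_n (K := C_AbsRing) z k)
      (g k : C_NormedModule)) N = csum (fun k => g k * z ^ k)%C (S N)).
  { assert (Hp : forall k, pow_n (K := C_AbsRing) z k = (z ^ k)%C).
    { induction k as [|k IH]; [reflexivity|]. simpl pow_n. rewrite IH, Cpow_S. reflexivity. }
    induction N as [|N IH].
    - rewrite sum_O, Hp. unfold scal; simpl. unfold mult; simpl. ring.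
    - rewrite sum_Sn, IH, Hp. unfold scal, plus; simpl. unfold mult; simpl. ring. }
  simpl in Hm. rewrite Hsum in Hm.
  replace (csum (fun k => g k * z ^ k) n - l)%C
    with ((csum (fun k => g k * z ^ k) (S (n + m)) - l)
      - (csum (fun k => g k * z ^ k) (S (n + m)) - csum (fun k => g k * z ^ k) n))%C by ring.
  unfold Cminus at 1. eapply Rle_trans; [apply Cmod_triangle|]. rewrite Cmod_opp.
  assert (Ht := csum_tail_bound B rho z n (S m) HB Hr Hz).
  rewrite Nat.add_succ_r in Ht.
  enough (B * rho ^ n * (1 - rho ^ S m) / (1 - rho) <= B * rho ^ n / (1 - rho)) by lra.
  apply Rmult_le_compat_r; [left; apply Rinv_0_lt_compat; lra|].
  assert (H1 : 0 <= B * rho ^ n) by (apply Rmult_le_pos; [exact HB0|apply pow_le; lra]).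
  assert (H2 : 0 <= rho ^ S m) by (apply pow_le; lra). nra.
Qed.

Hypothesis Hgnz : forall z : C, Cmod z < 1 ->
  exists l : C, is_pseries (K := C_AbsRing) (V := C_NormedModule) g z l /\ l <> RtoC 0.

(** Compactness of the disc of radius r. Continuity of the sum is replaced by a Taylor polynomial
    whose error is uniform on that disc. *)
Lemma pseries_lower_bound (r : R) : 0 <= r < 1 ->
  exists c, 0 < c /\ forall z l, Cmod z <= r ->
    is_pseries (K := C_AbsRing) (V := C_NormedModule) g z l -> c <= Cmod l.
Proof.
  intros Hr. assert (HB := coef_bound). set (B := S2 + 1) in HB.
  assert (HB0 : 0 <= B) by (eapply Rle_trans; [apply Cmod_ge_0|exact (HB O)]).
  assert (Hdel : forall w : C, exists d : posreal,
    forall z l, Cmod (z - w)%C < 2 * d -> Cmod z <= r ->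
      is_pseries (K := C_AbsRing) (V := C_NormedModule) g z l -> pos d <= Cmod l).
  { intros w. destruct (Rle_dec (Cmod w) r) as [Hw|Hw].
    - destruct (Hgnz w ltac:(lra)) as [l0 [Hl0 Hnz]].
      assert (Hm := proj1 (Cmod_gt_0 l0) Hnz). set (m := Cmod l0) in *.
      (* Three errors of m / 8, from the tails at w and at z and from the variation of the Taylor
         polynomial, leave |l| >= 5 m / 8. *)
      destruct (pow_small (B / (1 - r)) r (m / 8)) as [N HN]; try lra.
      { apply Rdiv_le_0_compat; lra. }
      specialize (HN N (Nat.le_refl N)).
      replace (B / (1 - r) * r ^ N) with (B * r ^ N / (1 - r)) in HN by (field; lra).
      destruct (poly_lipschitz (dilate_trunc 1 N)) as [M [HM HL]].
      assert (Hd : 0 < Rmin (m / 2) (m / 16 / M)).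
      { apply Rmin_glb_lt; [lra|]. apply Rdiv_lt_0_compat; lra. }
      exists (mkposreal _ Hd). intros z l Hzw Hz Hl. simpl in Hzw |- *.
      eapply Rle_trans; [apply Rmin_l|].
      assert (H1 := pseries_tail_bound B r w l0 N HB Hr Hw Hl0).
      assert (H2 := pseries_tail_bound B r z l N HB Hr Hz Hl).
      assert (H3 := HL w z ltac:(lra) ltac:(lra)).
      rewrite !eval_dilate_trunc, !Cmult_1_l in H3.
      assert (H4 : M * Cmod (w - z)%C <= m / 8).
      { rewrite Cmod_minus_sym. assert (Hmin := Rmin_r (m / 2) (m / 16 / M)).
        replace (m / 8) with (M * (2 * (m / 16 / M))) by (field; lra).
        apply Rmult_le_compat_l; lra. }
      set (sw := csum (fun k => g k * w ^ k)%C N) in *.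
      set (sz := csum (fun k => g k * z ^ k)%C N) in *.
      replace l with (l0 - ((l0 - sw) + (sw - sz) + (sz - l)))%C by ring.
      eapply Rle_trans; [|apply Cmod_minus_ge]. fold m.
      assert (H5 := Cmod_triangle (l0 - sw + (sw - sz)) (sz - l)).
      assert (H6 := Cmod_triangle (l0 - sw) (sw - sz)).
      rewrite (Cmod_minus_sym l0) in H6. lra.
    (* A center outside the disc of radius r gets a ball that misses this disc, so its condition is
       vacuous. *)
    - assert (Hd : 0 < (Cmod w - r) / 2) by lra.
      exists (mkposreal _ Hd). intros z l Hzw Hz. exfalso. simpl in Hzw.
      assert (H := Cmod_minus_ge w z). rewrite Cmod_minus_sym in H. lra. }
  apply ClassicalEpsilon.choice in Hdel. destruct Hdel as [del Hdel].
  (* Compactness of a square yields closeness in each coordinate; adding the two is why [Hdel] uses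
     twice the radius. *)
  destruct (compactness_value_2d (-1) 1 (-1) 1 (fun u v => del (u, v))) as [d Hd].
  exists d. split; [apply cond_pos|]. intros z l Hz Hl.
  assert (Hm := Rmax_Cmod z).
  assert (H1 := Rmax_l (Rabs (fst z)) (Rabs (snd z))).
  assert (H2 := Rmax_r (Rabs (fst z)) (Rabs (snd z))).
  assert (Hx : -1 <= fst z <= 1) by (apply Rabs_le_between; lra).
  assert (Hy : -1 <= snd z <= 1) by (apply Rabs_le_between; lra).
  destruct (NNPP _ (Hd _ _ Hx Hy)) as [u [v [_ [_ [Hu [Hv Hdd]]]]]].
  eapply Rle_trans; [exact Hdd|]. apply (Hdel (u, v) z); auto.
  assert (Hp := cond_pos (del (u, v))).
  apply Rle_lt_trans with (Rabs (fst z - u) + Rabs (snd z - v)); [|lra].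
  apply Cmod_le_sq; [generalize (Rabs_pos (fst z - u)) (Rabs_pos (snd z - v)); lra|].
  simpl fst; simpl snd.
  replace (fst z + - u) with (fst z - u) by ring. replace (snd z + - v) with (snd z - v) by ring.
  rewrite <- (pow2_abs (fst z - u)), <- (pow2_abs (snd z - v)).
  generalize (Rabs_pos (fst z - u)) (Rabs_pos (snd z - v)); intros. nra.
Qed.

(** Dilation is forced by the boundary: g is only known to be nonzero inside, whereas g(r z) is
    bounded below on the closed disc. The degree is fixed after r, since the tail must be small
    against that lower bound. *)
Lemma zero_free_poly_approx (eta : R) : 0 < eta ->
  exists q c, 0 < c /\ (forall z, Cmod z <= 1 -> c <= Cmod (poly_eval q z)) /\
    H2_dist2 g q <= eta.
Proof.
  intros Heta. assert (HB := coef_bound).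
  assert (HS : 0 <= S2).
  { apply (is_lim_seq_le (fun _ => 0) (sum_n (fun k => Cmod (g k) ^ 2)) 0 S2).
    - intros n. rewrite <- psq_dilate_trunc. apply psq_ge_0.
    - apply is_lim_seq_const.
    - exact (Series_correct _ Hg2). }
  assert (HK : exists K, Rabs (psq (dilate_trunc 1 K) - S2) < eta / 2).
  { assert (Hs : is_lim_seq (sum_n (fun k => Cmod (g k) ^ 2)) S2)
      by exact (Series_correct _ Hg2).
    apply is_lim_seq_spec in Hs.
    destruct (Hs (mkposreal (eta / 2) ltac:(lra))) as [m Hm].
    exists (S m). rewrite psq_dilate_trunc. apply Hm, Nat.le_refl. }
  destruct HK as [K HK].
  (* For k < K one gets 1 - r^k <= K t = tau; the minimum of 1 and eta / 2 gives tau <= 1 and tau S2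
     <= eta / 2, hence tau^2 S2 <= eta / 2. *)
  set (t := Rmin (1 / 2) (Rmin 1 (eta / 2) / ((INR K + 1) * (S2 + 1)))).
  assert (HK0 := pos_INR K).
  assert (Hden : 0 < (INR K + 1) * (S2 + 1)) by nra.
  assert (Hmin : 0 < Rmin 1 (eta / 2)) by (apply Rmin_glb_lt; lra).
  assert (Ht : 0 < t) by (apply Rmin_glb_lt; [lra|now apply Rdiv_lt_0_compat]).
  assert (Ht1 : t <= 1 / 2) by apply Rmin_l.
  assert (Ht2 : t * ((INR K + 1) * (S2 + 1)) <= Rmin 1 (eta / 2)).
  { apply Rle_div_r; [exact Hden|apply Rmin_r]. }
  assert (Hm1 := Rmin_l 1 (eta / 2)). assert (Hm2 := Rmin_r 1 (eta / 2)).
  set (tau := INR K * t). assert (Htau0 : 0 <= tau) by (apply Rmult_le_pos; lra).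
  assert (Htau : tau * (S2 + 1) <= Rmin 1 (eta / 2)) by (unfold tau; nra).
  assert (Htau1 : tau <= 1) by nra.
  assert (Htau2 : tau ^ 2 * S2 <= eta / 2).
  { assert (tau * S2 <= eta / 2) by nra. assert (0 <= tau * S2) by nra. nra. }
  set (r := 1 - t). assert (Hr : 0 <= r < 1) by (unfold r; lra).
  destruct (pseries_lower_bound r Hr) as [c [Hc Hlow]].
  assert (HB0 : 0 <= S2 + 1) by lra.
  destruct (pow_small ((S2 + 1) / (1 - r)) r (c / 2)) as [N HN]; try lra.
  { apply Rdiv_le_0_compat; lra. }
  set (n := Nat.max K N). specialize (HN n ltac:(unfold n; lia)).
  exists (dilate_trunc r n), (c / 2). split; [lra|]. split.
  - intros z Hz. rewrite eval_dilate_trunc.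
    assert (Hrz : Cmod (RtoC r * z)%C <= r).
    { rewrite Cmod_mult, Cmod_R, Rabs_pos_eq by lra. nra. }
    destruct (Hgnz (RtoC r * z)%C ltac:(lra)) as [l [Hl _]].
    assert (H1 := Hlow _ _ Hrz Hl).
    assert (H2 := pseries_tail_bound (S2 + 1) r _ l n HB Hr Hrz Hl).
    replace ((S2 + 1) / (1 - r) * r ^ n) with ((S2 + 1) * r ^ n / (1 - r)) in HN
      by (field; lra).
    rewrite Cmod_minus_sym in H2. apply Cmod_le_minus in H2. lra.
  - assert (HTs := is_series_psq (dilate_trunc 1 K)).
    assert (Hgs : is_series (fun k => Cmod (g k) ^ 2) S2) by exact (Series_correct _ Hg2).
    (* The majorant is tau^2 |g_k|^2 for k < K, and at least |g_k|^2 from K on, where the Taylor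
       polynomial has no coefficient left to subtract. *)
    assert (Hmaj := is_series_plus _ _ _ _ (is_series_scal (tau ^ 2) _ _ Hgs)
                      (is_series_minus _ _ _ _ Hgs HTs)).
    apply Rle_trans with (tau ^ 2 * S2 + (S2 - psq (dilate_trunc 1 K))).
    2: { apply Rabs_def2 in HK. lra. }
    erewrite <- is_series_unique; [|exact Hmaj].
    apply Series_le; [|eexists; exact Hmaj].
    intros k. split; [apply pow2_ge_0|].
    change (Cmod (g k - poly_coef (dilate_trunc r n) k)%C ^ 2 <=
      tau ^ 2 * Cmod (g k) ^ 2 + (Cmod (g k) ^ 2 - Cmod (poly_coef (dilate_trunc 1 K) k) ^ 2)).
    assert (Hg0 := pow2_ge_0 (Cmod (g k))).
    assert (Hlt : forall s, (g k - g k * RtoC s)%C = (RtoC (1 - s) * g k)%C)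
      by (intros s; rewrite RtoC_minus; ring).
    assert (Hp := one_minus_pow_le r k ltac:(lra)).
    destruct (Nat.lt_ge_cases k K) as [HkK|HkK].
    + rewrite !coef_dilate_trunc by (unfold n; lia).
      rewrite Hlt. rewrite pow1, Cmult_1_r, Cmod_mult, Cmod_R.
      rewrite Rabs_pos_eq by lra. rewrite Rpow_mult_distr.
      assert (HkK' : INR k <= INR K) by (apply le_INR; lia).
      assert (Hle : 1 - r ^ k <= tau).
      { eapply Rle_trans; [apply Hp|]. unfold tau, r. nra. }
      assert (Hle2 : (1 - r ^ k) ^ 2 <= tau ^ 2) by (apply pow_incr; lra).
      nra.
    + rewrite (coef_dilate_trunc_high 1 K) by exact HkK. rewrite Cmod_0.
      assert (Hrk : 0 <= r ^ k) by (apply pow_le; lra).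
      apply Rle_trans with (Cmod (g k) ^ 2); [|nra].
      destruct (Nat.lt_ge_cases k n) as [Hkn|Hkn].
      * rewrite coef_dilate_trunc by exact Hkn. rewrite Hlt.
        rewrite Cmod_mult, Cmod_R, Rabs_pos_eq by lra. rewrite Rpow_mult_distr.
        assert ((1 - r ^ k) ^ 2 <= 1 ^ 2) by (apply pow_incr; lra). nra.
      * rewrite coef_dilate_trunc_high by exact Hkn.
        replace (g k - 0)%C with (g k) by ring. lra.
Qed.

End Dilation.

(** * Simultaneous approximation *)

Lemma small_covers_subset (A B : C -> Prop) :
  (forall z, A z -> B z) -> small_covers B -> small_covers A.
Proof.
  intros HAB HB eps He. destruct (HB eps He) as [L [d [H1 [H2 [H3 H4]]]]].
  exists L, d. repeat split; auto. intros z Hz. apply H4, HAB, Hz.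
Qed.

Lemma psq_psub_triangle P Q R :
  psq (psub Q R) <= 2 * psq (psub Q P) + 2 * psq (psub P R).
Proof.
  assert (H := psq_le (psub Q R) (psub Q P) (psub P R) nil 2 2 0).
  change (Re (poly_eval nil (RtoC 0))) with 0 in H. rewrite !Rplus_0_r in H.
  apply H. intros z _. change (Re (poly_eval nil z)) with 0.
  rewrite !Rplus_0_r, !eval_sub.
  replace (poly_eval Q z - poly_eval R z)%C
    with ((poly_eval Q z - poly_eval P z) - - (poly_eval P z - poly_eval R z))%C by ring.
  rewrite <- (Cmod_opp (poly_eval P z - poly_eval R z)). apply cmod_sq_minus_le.
Qed.

(** * Correcting the pieces one after another *)

Section Pieces.

Variables (E : C -> Prop) (lab : C -> nat) (d : R) (w : nat -> C) (q : list C).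
Hypotheses
  (HEcirc : forall z, E z -> Cmod z = 1)
  (Hcov : small_covers E)
  (Hd : 0 < d)
  (Hsep : forall z y, E z -> E y -> lab z <> lab y -> d <= Cmod (z - y)%C)
  (Hw : forall j, w j <> RtoC 0)
  (Hq : forall z, Cmod z <= 1 -> poly_eval q z <> RtoC 0).

(** Each correction slightly disturbs the pieces already treated, so the induction runs over all
    [eta] and calls its hypothesis with a smaller one. *)
Lemma modify_on_pieces (m : nat) (eta : R) : 0 < eta ->
  exists P,
    (forall z, Cmod z <= 1 -> poly_eval P z <> RtoC 0) /\
    (forall z, E z -> (lab z < m)%nat ->
       Cmod (poly_eval P z - w (lab z) * poly_eval q z)%C <= eta) /\
    (forall z, E z -> (m <= lab z)%nat ->
       Cmod (poly_eval P z - poly_eval q z)%C <= eta) /\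
    psq (psub P q) <= eta.
Proof.
  revert eta. induction m as [|m IH]; intros eta Heta.
  - exists q. split; [exact Hq|]. split; [intros; lia|]. split.
    + intros z _ _. replace (poly_eval q z - poly_eval q z)%C with (RtoC 0) by ring.
      rewrite Cmod_0; lra.
    + assert (H := psq_le (psub q q) nil nil nil 0 0 0).
      change (Re (poly_eval nil (RtoC 0))) with 0 in H.
      rewrite !Rmult_0_l, !Rplus_0_r in H. eapply Rle_trans; [apply H|lra].
      intros z _. change (Re (poly_eval nil z)) with 0. rewrite eval_sub.
      replace (poly_eval q z - poly_eval q z)%C with (RtoC 0) by ring.
      rewrite Cmod_0. lra.
  - assert (Hwm := Cmod_ge_0 (w m)).
    (* Correcting piece m multiplies its previous error by |w m|, so both e1 and |w m| e1 must stay
       below eta / 4. *)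
    set (e1 := eta / 4 / (1 + Cmod (w m))).
    assert (He1 : 0 < e1) by (apply Rdiv_lt_0_compat; lra).
    assert (He1m : e1 * (1 + Cmod (w m)) = eta / 4) by (unfold e1; field; lra).
    assert (He1w : Cmod (w m) * e1 <= eta / 4) by nra.
    assert (He1e : e1 <= eta / 4) by nra.
    destruct (IH e1 He1) as [P [HP1 [HP2 [HP3 HP4]]]].
    destruct (modify_poly (fun z => E z /\ lab z = m) (fun z => E z /\ lab z <> m) d
      (eta / 4) (w m) P) as [Q [HQ1 [HQ2 [HQ3 HQ4]]]]; auto.
    + apply small_covers_subset with E; tauto.
    + intros z [Hz _]. rewrite HEcirc by exact Hz. lra.
    + intros z [Hz _]. rewrite HEcirc by exact Hz. lra.
    + intros a z [Ha Hla] [Hz Hlz]. apply Hsep; congruence.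
    + lra.
    + exists Q. split; [exact HQ1|]. split; [|split].
      * intros z Hz Hlz. destruct (Nat.eq_dec (lab z) m) as [Heq|Hne].
        -- rewrite Heq.
           replace (poly_eval Q z - w m * poly_eval q z)%C
             with ((poly_eval Q z - w m * poly_eval P z)
                   + w m * (poly_eval P z - poly_eval q z))%C by ring.
           eapply Rle_trans; [apply Cmod_triangle|]. rewrite Cmod_mult.
           assert (H1 := HQ2 z (conj Hz Heq)). assert (H2 := HP3 z Hz ltac:(lia)). nra.
        -- replace (poly_eval Q z - w (lab z) * poly_eval q z)%C
             with ((poly_eval Q z - poly_eval P z)
                   + (poly_eval P z - w (lab z) * poly_eval q z))%C by ring.
           eapply Rle_trans; [apply Cmod_triangle|].
           assert (H1 := HQ3 z (conj Hz Hne)). assert (H2 := HP2 z Hz ltac:(lia)). lra.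
      * intros z Hz Hlz.
        replace (poly_eval Q z - poly_eval q z)%C
          with ((poly_eval Q z - poly_eval P z) + (poly_eval P z - poly_eval q z))%C by ring.
        eapply Rle_trans; [apply Cmod_triangle|].
        assert (Hne : lab z <> m) by lia.
        assert (H1 := HQ3 z (conj Hz Hne)). assert (H2 := HP3 z Hz ltac:(lia)). lra.
      * assert (H := psq_psub_triangle P Q q). lra.
Qed.

End Pieces.

Lemma filterlim_continuous_within (E : C -> Prop) (f : C -> C) z :
  filterlim f (within E (locally z)) (locally (f z)) -> continuous_within E f z.
Proof.
  intros Hf eta Heta.
  destruct (Hf _ (locally_Cmod (f z) eta Heta)) as [d Hd]. exists d. split; [apply cond_pos|].
  intros y Hy Hyz. apply Hd; [|exact Hy]. apply C_NormedModule_mixin_compat1. exact Hyz.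
Qed.

Lemma simultaneous_approx
  (E : C -> Prop) (g : nat -> C) (f : C -> C) (eps : R)
  (HEcirc : forall z : C, E z -> Cmod z = 1)
  (HEclosed : closed E)
  (HEnull : null_on_circle E)
  (Hg2 : ex_series (fun k => (Cmod (g k)) ^ 2))
  (Hgnz : forall z : C, Cmod z < 1 ->
     exists l : C, is_pseries (K := C_AbsRing) (V := C_NormedModule) g z l /\ l <> RtoC 0)
  (Hfcont : forall z : C, E z -> continuous_within E f z)
  (Hfnz : forall z : C, E z -> f z <> RtoC 0) :
  0 < eps -> exists P,
    (forall z, Cmod z <= 1 -> poly_eval P z <> RtoC 0) /\
    H2_dist2 g P <= eps /\
    (forall z, E z -> Cmod (poly_eval P z - f z)%C <= eps).
Proof.
  intros Heps.
  assert (Hcov := null_small_covers E HEcirc HEclosed HEnull).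
  destruct (zero_free_poly_approx g Hg2 Hgnz (eps / 4) ltac:(lra)) as [q [c [Hc [Hq Hgq]]]].
  destruct (bounded_on_closed E HEcirc HEclosed f Hfcont) as [B [HB HfB]].
  destruct (uniformly_continuous_on_closed E HEcirc HEclosed f (eps / 4) Hfcont ltac:(lra))
    as [du [Hdu Hfu]].
  destruct (poly_lipschitz q) as [M [HM HqM]].
  assert (HBc : 0 < B / c * M).
  { apply Rmult_lt_0_compat; [apply Rdiv_lt_0_compat|]; lra. }
  (* Within a piece f varies by at most eps / 4, and so does q after multiplication by f / q, of
     modulus at most B / c. *)
  set (rho := Rmin (du / 2) (eps / 4 / (B / c * M))).
  assert (Hrho : 0 < rho) by (apply Rmin_glb_lt; [lra|apply Rdiv_lt_0_compat; lra]).
  assert (Hrho1 : rho <= du / 2) by apply Rmin_l.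
  assert (Hrho2 : rho * (B / c * M) <= eps / 4).
  { apply Rle_div_r; [exact HBc|apply Rmin_r]. }
  destruct (small_pieces E rho Hcov Hrho) as [lab [n [d [Hd [Hlab Hpc]]]]].
  assert (Hqnz : forall z, Cmod z <= 1 -> poly_eval q z <> RtoC 0).
  { intros z Hz. apply Cmod_gt_0. assert (H := Hq z Hz). lra. }
  assert (Hw : forall j, exists w, w <> RtoC 0 /\
    forall z, E z -> lab z = j -> Cmod (w * poly_eval q z - f z)%C <= eps / 2).
  { intros j. destruct (classic (exists y, E y /\ lab y = j)) as [[y [Hy Hyj]]|H].
    (* A label without points of [E] gets the value 1, so that [w] vanishes nowhere. *)
    2: { exists (RtoC 1). split; [apply Cmod_pos_of_Re; unfold Re; simpl; lra|].
         intros z Hz Hzj. destruct H. now exists z. }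
    assert (Hy1 : Cmod y <= 1) by (rewrite HEcirc; [lra|exact Hy]).
    assert (Hqy := Hqnz y Hy1).
    exists (f y / poly_eval q y)%C. split.
    { apply Cmult_neq_0; [now apply Hfnz|]. apply Cmod_gt_0.
      rewrite Cmod_inv by exact Hqy. now apply Rinv_0_lt_compat, Cmod_gt_0. }
    intros z Hz Hzj.
    assert (Hz1 : Cmod z <= 1) by (rewrite HEcirc; [lra|exact Hz]).
    assert (Hzy : Cmod (z - y)%C <= rho) by (apply Hpc; congruence).
    replace (f y / poly_eval q y * poly_eval q z - f z)%C
      with (f y / poly_eval q y * (poly_eval q z - poly_eval q y) + - (f z - f y))%C
      by (field; exact Hqy).
    eapply Rle_trans; [apply Cmod_triangle|].
    rewrite Cmod_opp, Cmod_mult, Cmod_div by exact Hqy.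
    assert (H1 := Hfu z y Hz Hy ltac:(lra)).
    enough (Cmod (f y) / Cmod (poly_eval q y) * Cmod (poly_eval q z - poly_eval q y)%C
            <= eps / 4) by lra.
    apply Rle_trans with (B / c * (M * rho)); [|lra].
    assert (Hqc := Hq y Hy1).
    apply Rmult_le_compat; [| apply Cmod_ge_0 | |].
    - apply Rdiv_le_0_compat; [apply Cmod_ge_0|lra].
    - apply Rmult_le_compat; [apply Cmod_ge_0| |now apply HfB|].
      + left; apply Rinv_0_lt_compat; lra.
      + apply Rinv_le_contravar; lra.
    - eapply Rle_trans; [now apply HqM|]. apply Rmult_le_compat_l; lra. }
  apply ClassicalEpsilon.choice in Hw. destruct Hw as [w Hw].
  destruct (modify_on_pieces E lab d w q HEcirc Hcov Hd
    (fun z y Hz Hy => proj1 (Hpc z y Hz Hy)) (fun j => proj1 (Hw j)) Hqnz n (eps / 4))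
    as [P [HP1 [HP2 [_ HP4]]]]; [lra|].
  exists P. split; [exact HP1|]. split.
  (* Squared distances double both errors, hence eps / 4 for each. *)
  - assert (H := H2_dist2_psub g P q Hg2). lra.
  - intros z Hz. assert (H1 := HP2 z Hz (Hlab z Hz)).
    assert (H2 := proj2 (Hw (lab z)) z Hz eq_refl).
    replace (poly_eval P z - f z)%C
      with ((poly_eval P z - w (lab z) * poly_eval q z)
            + (w (lab z) * poly_eval q z - f z))%C by ring.
    eapply Rle_trans; [apply Cmod_triangle|]. lra.
Qed.

Theorem theorem1p2
  (E : C -> Prop) (g : nat -> C) (f : C -> C)
  (HEcirc : forall z : C, E z -> Cmod z = 1)
  (HEclosed : closed E)
  (HEnull : null_on_circle E)
  (Hg2 : ex_series (fun k => (Cmod (g k)) ^ 2))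
  (Hgnz : forall z : C, Cmod z < 1 ->
     exists l : C, is_pseries (K := C_AbsRing) (V := C_NormedModule) g z l /\ l <> RtoC 0)
  (Hfcont : forall z : C, E z -> filterlim f (within E (locally z)) (locally (f z)))
  (Hfnz : forall z : C, E z -> f z <> RtoC 0) :
  exists P : nat -> list C,
    (forall (n : nat) (z : C), Cmod z <= 1 -> poly_eval (P n) z <> RtoC 0) /\
    is_lim_seq (fun n => H2_dist2 g (P n)) 0 /\
    (forall eps : R, 0 < eps -> exists N : nat, forall n : nat, (N <= n)%nat ->
       forall z : C, E z -> Cmod (Cminus (poly_eval (P n) z) (f z)) < eps).
Proof.
  assert (HP : forall n : nat, exists P,
    (forall z, Cmod z <= 1 -> poly_eval P z <> RtoC 0) /\
    H2_dist2 g P <= / INR (S n) /\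
    (forall z, E z -> Cmod (poly_eval P z - f z)%C <= / INR (S n))).
  { intros n. apply (simultaneous_approx E g f); auto.
    - intros z Hz. now apply filterlim_continuous_within, Hfcont.
    - apply Rinv_0_lt_compat, lt_0_INR. lia. }
  apply ClassicalEpsilon.choice in HP. destruct HP as [P HP].
  assert (Hsmall : forall eps, 0 < eps -> exists N : nat, forall n, (N <= n)%nat ->
    / INR (S n) < eps).
  { intros eps He. destruct (archimed_cor1 eps He) as [N [HN HN0]]. exists N. intros n Hn.
    eapply Rle_lt_trans; [|exact HN].
    apply Rinv_le_contravar; [now apply lt_0_INR|apply le_INR; lia]. }
  exists P. split; [|split].
  - intros n. apply HP.
  - apply is_lim_seq_spec. intros eps. destruct (Hsmall eps (cond_pos eps)) as [N HN].
    exists N. intros n Hn. rewrite Rminus_0_r, Rabs_pos_eq by now apply H2_dist2_ge_0.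
    eapply Rle_lt_trans; [apply HP|now apply HN].
  - intros eps He. destruct (Hsmall eps He) as [N HN]. exists N. intros n Hn z Hz.
    eapply Rle_lt_trans; [now apply HP|now apply HN].
Qed.
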